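(* Let $G$ be a group with generating set $S_G$ acting from the right on a set $X$, let $x_0\in X$, and let $A$ be a group with generating set $S_A$. Let $W=A\wr_X G$ be the permutation wreath product, with Cayley graph $(W,S_A\cup S_G)$. Let $\alpha>0$. Assume $\#S_A\ge 2$ and that there exists $C_2>0$ such that for all $n\in\mathbb{N}$ there is a word $w_n=g_1\cdots g_n$ of length $n$ in letters $g_i\in S_G$ satisfying $$\#\mathcal{O}(w_n)\ge C_2\,n^{\alpha}.$$ Then there is a spherically symmetric tree $\mathcal{T}$ in the Cayley graph $(W,S_A\cup S_G)$ (a subgraph which is a tree, rooted at the identity) satisfying $$\mathrm{IBN}(\mathcal{T})\ge\alpha.$$
   Context: Permutation wreath product: $\sum_X A$ is the group of functions $f:X\to A$ with finite support $\{x: f(x)\ne 1_A\}$. $W=A\wr_XG$ is the semidirect product of $\sum_X A$ with $G$; elements are written $fg$ with $f\in\sum_XA$, $g\in G$, and the product is $$(f_1g_1)\cdot(f_2g_2)=(g_2^{-1}\cdot f_1)\,f_2\,g_1g_2,\qquad (g^{-1}\cdot f)(x)=f(xg^{-1}).$$ An element $a\in A$ is identified with the function $f_a\in\sum_XA$ given by $f_a(x_0)=a$ and $f_a(x)=1_A$ for $x\ne x_0$. With this identification $S_A\cup S_G\subset W$, and the Cayley graph $(W,S_A\cup S_G)$ has vertex set $W$ and edges joining $u$ to $us$ for $s\in S_A\cup S_G$. Inverted orbit of a word $w=g_1g_2\cdots g_\ell$ with $g_i\in S_G$: $$\mathcal{O}(w)=\{x_0g_\ell,\ x_0g_{\ell-1}g_\ell,\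 \dots,\ x_0g_1g_2\cdots g_\ell\}.$$ A rooted tree is spherically symmetric if all vertices at the same distance from the root have the same number of children. Trees are locally finite, infinite and rooted. For a rooted tree $\mathcal{T}=(V,E,\varrho)$, $|v|$ is the graph distance in $\mathcal{T}$ from $v$ to the root; for an edge $e$ with endpoints $e^-,e^+$ where $|e^+|=|e^-|+1$, put $|e|=|e^+|$. A cutset is a set $\pi\subset E$ such that every infinite self-avoiding path from $\varrho$ to infinity has exactly one edge in $\pi$; $\Pi$ is the set of all cutsets. The intermediate branching number is $$\mathrm{IBN}(\mathcal{T})=\sup\Big\{\lambda>0:\ \inf_{\pi\in\Pi}\sum_{e\in\pi}\exp(-|e|^{\lambda})>0\Big\},$$ with $\sup\emptyset=0$. *)

(* Defs.v *)
From HB Require Import structures.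
From mathcomp Require Import all_boot all_order all_algebra.
From mathcomp Require Import finmap.
From mathcomp Require Import all_classical all_reals all_analysis.

Set Implicit Arguments.
Unset Strict Implicit.
Unset Printing Implicit Defensive.

Import Order.TTheory GRing.Theory Num.Theory.

Local Open Scope classical_set_scope.
Local Open Scope card_scope.
Local Open Scope ring_scope.

Section Graphs.
Variable V : choiceType.

(* Loops are allowed. *)
Record graph := Graph {
  vertices : set V;
  adj : rel V;
  adj_sym : symmetric adj;
  adj_vertices : forall x y, adj x y -> vertices x }.

Implicit Types (T H : graph) (x y : V).

Definition subgraph T H : Prop :=
  vertices T `<=` vertices H /\ (forall x y, adj T x y -> adj H x y).

Definition walk T x y (n : nat) : Prop :=
  exists p : seq V, [/\ path (adj T) x p, last x p = y & size p = n].

Definition connected_graph T : Prop :=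
  forall x y, vertices T x -> vertices T y -> exists n, walk T x y n.

(* ucycle has a simple closed walk of size 2 for every edge (back and forth)
   and of size 1 for every loop: the former are not cycles, the latter are. *)
Definition acyclic T : Prop :=
  forall c : seq V, ucycle (adj T) c -> c = [::] \/ size c = 2.

(* Junk value 0 if x and y are not joined by a walk. *)
Definition gdist T x y : nat :=
  xget 0%N [set n | walk T x y n /\ forall m, walk T x y m -> (n <= m)%N].

Definition rooted_tree T (rho : V) : Prop :=
  [/\ vertices T rho, connected_graph T, acyclic T,
      (forall x, finite_set [set y | adj T x y]) & infinite_set (vertices T)].

Definition depth T (rho x : V) : nat := gdist T rho x.

Definition children T (rho x : V) : set V :=
  [set y | adj T x y /\ depth T rho y = (depth T rho x).+1].

Definition spherically_symmetric T (rho : V) : Prop :=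
  forall x y, vertices T x -> vertices T y ->
    depth T rho x = depth T rho y -> children T rho x #= children T rho y.

(* An edge e is represented by the pair (e^-, e^+); in a tree every edge has
   exactly one endpoint farther from the root. *)
Definition edges T (rho : V) : set (V * V) :=
  [set e | adj T e.1 e.2 /\ depth T rho e.2 = (depth T rho e.1).+1].

Definition edepth T (rho : V) (e : V * V) : nat := depth T rho e.2.

Definition ray T (rho : V) (r : nat -> V) : Prop :=
  [/\ r 0%N = rho, injective r & forall i, adj T (r i) (r i.+1)].

Definition ray_uses (r : nat -> V) (e : V * V) : Prop :=
  exists i, e = (r i, r i.+1) \/ e = (r i.+1, r i).

Definition cutset T (rho : V) (pi : set (V * V)) : Prop :=
  pi `<=` edges T rho /\
  forall r, ray T rho r -> exists! e, pi e /\ ray_uses r e.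

Definition cutset_sum (R : realType) T (rho : V) (lambda : R)
    (pi : set (V * V)) : \bar R :=
  \esum_(e in pi) (expR (- ((edepth T rho e)%:R `^ lambda)))%:E.

(* 0 is adjoined because the supremum of the empty set is 0 here, not -oo. *)
Definition IBN (R : realType) T (rho : V) : \bar R :=
  ereal_sup (0%E |` [set lambda%:E | lambda in [set lambda : R | 0 < lambda /\
    (0 < ereal_inf [set cutset_sum T rho lambda pi | pi in cutset T rho])%E]]).

End Graphs.

Definition subgroup_set (G : groupType) (H : set G) : Prop :=
  [/\ H 1%g, (forall x y, H x -> H y -> H (x * y)%g)
    & (forall x, H x -> H x^-1%g)].

Definition generates (G : groupType) (S : set G) : Prop :=
  smallest (@subgroup_set G) S = [set: G].

Section Cayley.
Variables (G : groupType) (S : set G).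

Definition cayley_adj : rel G := fun u v =>
  `[< exists2 s, S s & v = (u * s)%g \/ u = (v * s)%g >].

Lemma cayley_adj_sym : symmetric cayley_adj.
Proof.
by move=> u v; apply/asboolP/asboolP => -[s Ss [->|->]]; exists s; auto.
Qed.

Definition cayley : graph G :=
  @Graph G [set: G] cayley_adj cayley_adj_sym (fun _ _ _ => I).

End Cayley.

Record right_action (G : groupType) (X : choiceType) := RightAction {
  ract :> X -> G -> X;
  ract1 : forall x, ract x 1%g = x;
  ractM : forall x g h, ract x (g * h)%g = ract (ract x g) h }.

Record wreath (A G : groupType) (X : choiceType) (act : right_action G X) :=
  Wreath { lamp : {fsfun X -> A with 1%g}; base : G }.

Section Wreath.
Variables (A G : groupType) (X : choiceType) (act : right_action G X).

Local Notation lamps := {fsfun X -> A with 1%g}.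
Local Notation W := (wreath A act).

Lemma ractK g : cancel (act^~ g) (act^~ g^-1%g).
Proof. by move=> x; rewrite -ractM mulgV ract1. Qed.

Lemma ractVK g : cancel (act^~ g^-1%g) (act^~ g).
Proof. by move=> x; rewrite -ractM mulVg ract1. Qed.

Definition lamps_mul (f1 f2 : lamps) : lamps :=
  [fsfun x in (finsupp f1 `|` finsupp f2)%fset => (f1 x * f2 x)%g].

Definition lamps_inv (f : lamps) : lamps :=
  [fsfun x in finsupp f => (f x)^-1%g].

Definition lamps_shift (g : G) (f : lamps) : lamps :=
  [fsfun x in [fset act y g | y in finsupp f]%fset => f (act x g^-1%g)].

Lemma lamps_mulE f1 f2 x : lamps_mul f1 f2 x = (f1 x * f2 x)%g.
Proof.
rewrite fsfunE in_fsetU.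
by case: finsuppP => _; case: finsuppP => _ //=; rewrite mulg1.
Qed.

Lemma lamps_invE f x : lamps_inv f x = (f x)^-1%g.
Proof. by rewrite fsfunE; case: finsuppP => // _; rewrite invg1. Qed.

(* lamps_shift g f is the function written g^-1 . f in the product of W. *)
Lemma lamps_shiftE g f x : lamps_shift g f x = f (act x g^-1%g).
Proof.
rewrite fsfunE; case: ifPn => // /imfsetP xP.
case: finsuppP => // yf; case: xP.
by exists (act x g^-1%g) => //=; rewrite ractVK.
Qed.

HB.instance Definition _ := gen_eqMixin W.
HB.instance Definition _ := gen_choiceMixin W.

Definition wreath_mul (u v : W) : W :=
  Wreath act (lamps_mul (lamps_shift (base v) (lamp u)) (lamp v))
         (base u * base v)%g.

Definition wreath_one : W := Wreath act [fsfun] 1%g.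

Definition wreath_inv (u : W) : W :=
  Wreath act (lamps_shift (base u)^-1%g (lamps_inv (lamp u))) (base u)^-1%g.

Lemma wreathP (u v : W) : lamp u =1 lamp v -> base u = base v -> u = v.
Proof. by case: u v => [f g] [f' g'] /= /fsfunP -> ->. Qed.

Lemma wreath_mulA : associative wreath_mul.
Proof.
move=> u v w; apply: wreathP => /= [x|]; last by rewrite mulgA.
by rewrite !(lamps_mulE, lamps_shiftE) invgM ractM mulgA.
Qed.

Lemma wreath_mul1 : left_id wreath_one wreath_mul.
Proof.
move=> u; apply: wreathP => /= [x|]; last by rewrite mul1g.
by rewrite !(lamps_mulE, lamps_shiftE) fsfunE mul1g.
Qed.

Lemma wreath_1mul : right_id wreath_one wreath_mul.
Proof.
move=> u; apply: wreathP => /= [x|]; last by rewrite mulg1.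
by rewrite !(lamps_mulE, lamps_shiftE) fsfunE mulg1 invg1 ract1.
Qed.

Lemma wreath_mulV : left_inverse wreath_one wreath_inv wreath_mul.
Proof.
move=> u; apply: wreathP => /= [x|]; last by rewrite mulVg.
by rewrite !(lamps_mulE, lamps_shiftE, lamps_invE) fsfunE invgK ractVK mulVg.
Qed.

Lemma wreath_Vmul : right_inverse wreath_one wreath_inv wreath_mul.
Proof.
move=> u; apply: wreathP => /= [x|]; last by rewrite mulgV.
by rewrite !(lamps_mulE, lamps_shiftE, lamps_invE) fsfunE invgK mulgV.
Qed.

HB.instance Definition _ := isGroup.Build W
  wreath_mulA wreath_mul1 wreath_1mul wreath_mulV wreath_Vmul.

Definition wreath_of_lamp (x0 : X) (a : A) : W :=
  Wreath act [fsfun x in [fset x0]%fset => a] 1%g.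

Definition wreath_of_base (g : G) : W := Wreath act [fsfun] g.

Definition wreath_gens (x0 : X) (SA : set A) (SG : set G) : set W :=
  wreath_of_lamp x0 @` SA `|` wreath_of_base @` SG.

(* For w = g_1 ... g_l: the points x0 (g_i ... g_l), 1 <= i <= l. *)
Definition inverted_orbit (x0 : X) (w : seq G) : {fset X} :=
  [fset act x0 (\prod_(g <- drop i w) g)%g | i in iota 0 (size w)]%fset.

End Wreath.

Arguments wreath_gens {A G X} act x0 SA SG.

(* Main.v *)
Require Import Defs.
From mathcomp Require Import all_boot all_order all_algebra.
From mathcomp Require Import finmap zify ring lra.
From mathcomp Require Import all_classical all_reals all_analysis.

Set Implicit Arguments.
Unset Strict Implicit.
Unset Printing Implicit Defensive.

Import Order.TTheory GRing.Theory Num.Theory.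
Local Open Scope classical_set_scope.
Local Open Scope ring_scope.

(** Fix [s <> 1] in [SA]. A vertex of the wreath product is described by a base
    point [g] and by the set of sites whose lamp equals [s]; a step either moves
    [g] along a letter or its inverse, or toggles the lamp at the site
    [x0 g^-1] under the cursor. Concatenating the given words of lengths
    [2 ^ k] yields one infinite walk [gam] in [G] whose first [t] positions
    have at least [c t^alpha] different sites under the cursor: the sites of
    one block are a translate of an inverted orbit ([nfresh_block]). Each first
    visit of a site is an opportunity to branch, since the lamp there has not
    been used before. A tree with [nu t] binary branchings before level [t],
    where [nu t >= d t^alpha - 2], has cutset sums bounded below for every
    exponent [lambda < alpha] ([cutset_mass], [stretched_exp_bound]).

    The difficulty is to follow the walk so that all the branches have equal
    lengths and that no vertex of the Cayley graph is met twice, whereas the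
    walk itself may return to the same base point as often as it likes, and
    [s] may be the only lamp move (as in Z/2). The branches are cut into stages.
    Stage [j] uses two first visits, at times [rho j < kap j]: the lamp of the
    separator [sep j] is always switched on, and the lamp of the second site
    [info j] stores the choice made in the stage. Just before time [kap j] the
    cursor stays during a run of steps on a site [hub j]; before that run it was
    at a different site [past j]. With the lamp at the hub toggled, a branch
    either walks through the run, steps to the new site, toggles [info j] and
    steps back, or first steps back to [past j], toggles it, returns and then
    walks through the run. Both itineraries have the same length and end at the
    same base point, where the hub is toggled back. Every change of direction
    comes with a change of the lamps, and between two changes the walk is
    replaced by a self-avoiding path, so no vertex is repeated within a stage
    ([keyed_stage_inj]). Different stages are told apart by their separators
    ([ray_state_inj_stage]).

    Two branches with different histories must not meet either, although [hub j]
    and [past j] may carry earlier information. The history is therefore encoded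
    with redundancy: three consecutive stages make the same choice, and their
    sites are selected among the first visits so that none of them is disturbed
    by a later stage of the same triple ([spread_fresh_times]). Hence histories
    that differ before the current triple differ at three sites at least, and
    toggling two sites cannot hide this ([lamps_before_far]). *)

(** * Trees given by their branches *)

(** [P b t] is the vertex at level [t] of the branch coded by the bits [b]; the
    first [nu t] bits decide it, and distinct prefixes give distinct vertices. *)
Section BinaryTree.
Variables (V : choiceType) (P : (nat -> bool) -> nat -> V) (nu : nat -> nat).
Hypothesis nu0 : nu 0 = 0%N.
Hypothesis nuS : forall t, (nu t <= nu t.+1 <= (nu t).+1)%N.
Hypothesis P_agree : forall b b' t,
  (forall i, (i < nu t)%N -> b i = b' i) -> P b t = P b' t.
Hypothesis P_inj : forall b b' t t', P b t = P b' t' ->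
  t = t' /\ forall i, (i < nu t)%N -> b i = b' i.

Definition step_rel : rel V := fun x y =>
  `[< exists b t, x = P b t /\ y = P b t.+1 >].

Definition tree_adj : rel V := fun x y => step_rel x y || step_rel y x.

Lemma tree_adj_sym : symmetric tree_adj.
Proof. by move=> x y; rewrite /tree_adj orbC. Qed.

Definition tree_vertices : set V := [set x | exists b t, x = P b t].

Lemma tree_adj_vertices x y : tree_adj x y -> tree_vertices x.
Proof.
by case/orP => /asboolP[b [t [? ?]]]; exists b; eexists; eassumption.
Qed.

Definition binary_tree : graph V := Graph tree_adj_sym tree_adj_vertices.

Local Notation T := binary_tree.
Local Notation root := (P (fun=> false) 0).

Lemma P_root b : P b 0 = root.
Proof. by apply: P_agree => i; rewrite nu0. Qed.

Lemma step_relP b t : step_rel (P b t) (P b t.+1).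
Proof. by apply/asboolP; exists b, t. Qed.

Lemma adj_succ b t : adj T (P b t) (P b t.+1).
Proof. by rewrite /= /tree_adj step_relP. Qed.

Lemma nu_le : {homo nu : m n / (m <= n)%N}.
Proof.
by apply: homo_leq => [//|n m p|t]; [exact: leq_trans|by case/andP: (nuS t)].
Qed.

Lemma adjE b t y : adj T (P b t) y ->
  (exists b', y = P b' t.+1 /\ P b' t = P b t) \/
  (exists s, t = s.+1 /\ y = P b s).
Proof.
case/orP => /asboolP[b' [t' [e1 e2]]].
  by left; exists b'; case: (P_inj e1) => tE _; rewrite e2 tE -e1 tE.
right; case: (P_inj e2) => tE ag; exists t'; split => //; rewrite e1.
apply: P_agree => i lti; rewrite ag// (leq_trans lti)//.
by rewrite tE; apply: nu_le.
Qed.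

Lemma walk_down b t : walk T root (P b t) t.
Proof.
rewrite -(P_root b); elim: t => [|t [p [pp lp sp]]]; first by exists [::].
exists (rcons p (P b t.+1)); rewrite rcons_path pp lp last_rcons size_rcons sp.
by split => //=; exact: adj_succ.
Qed.

(** A step of a walk raises the level by at most one, which is what makes the
    level equal to the distance from the root. *)
Lemma walk_root_level x n : walk T root x n ->
  exists b t, x = P b t /\ (t <= n)%N.
Proof.
case=> p []; elim/last_ind: p n x => [|p y IH] n x.
  by move=> _ /= <- _; exists (fun=> false), 0%N.
rewrite rcons_path last_rcons size_rcons => /andP[pp ly] <- <-.
have [b [t [e le]]] := IH _ _ pp erefl erefl.
move: ly; rewrite e => /adjE [[b' [-> _]]|[s [ts ->]]].
  by exists b', t.+1.
by exists b, s; split=> //; rewrite ts in le; apply: (leq_trans (ltnW le)).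
Qed.

Lemma depthP b t : depth T root (P b t) = t.
Proof.
rewrite /depth /gdist; case: xgetP => [n -> [w m]|]; last first.
  move=> /(_ t) []; split; first exact: walk_down.
  move=> m /walk_root_level[b' [t' [e]]].
  by case: (P_inj e) => <-.
apply/eqP; rewrite eqn_leq m /=; last exact: walk_down.
have [b' [t' [e]]] := walk_root_level w.
by case: (P_inj e) => <-.
Qed.

Lemma walk_sym x y n : walk T x y n -> walk T y x n.
Proof.
case=> p [pp lp sp]; exists (rev (belast x p)).
rewrite size_rev size_belast sp; split => //.
  by rewrite -lp rev_path; under eq_path => a b do rewrite adj_sym.
case: p pp lp {sp} => //= a p _ _.
by rewrite rev_cons last_rcons.
Qed.

Lemma walk_trans x y z m n : walk T x y m -> walk T y z n -> walk T x z (m + n).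
Proof.
case=> p [pp lp sp] [q [pq lq sq]]; exists (p ++ q).
by rewrite cat_path last_cat lp pp pq lq size_cat sp sq.
Qed.

Lemma binary_tree_connected : connected_graph T.
Proof.
move=> _ _ [b [t ->]] [b' [t' ->]]; exists (t + t')%N.
by apply: walk_trans (walk_sym (walk_down b t)) (walk_down b' t').
Qed.

(** A vertex of maximal level in a cycle has two neighbours in the cycle. Neither
    is above it, so both are its parent, and the cycle is an edge run back and
    forth. *)
Lemma binary_tree_acyclic : acyclic T.
Proof.
move=> [|x0 c0] uc; [by left|right].
move: (x0 :: c0) (mem_head x0 c0) uc => c xc uc {c0}.
pose lev := depth T root.
(* A vertex of maximal level, to which the cycle is then rotated. *)
have [x xinc xmax] : exists2 x, x \in c &
    forall y, y \in c -> (lev y <= lev x)%N.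
  have ex : exists n, n \in map lev c by exists (lev x0); rewrite map_f.
  have bd n : n \in map lev c -> (n <= \max_(k <- map lev c) k)%N.
    by move=> nc; rewrite (big_rem _ nc) /= leq_maxl.
  case: (ex_maxnP ex bd) => _ /mapP[x xinc ->] mx.
  by exists x => // y yc; apply: mx; rewrite map_f.
have [i d dE] := rot_to xinc.
have {uc} : ucycle (adj T) (x :: d) by rewrite -dE rot_ucycle.
have {}xmax y : y \in x :: d -> (lev y <= lev x)%N.
  by rewrite -dE mem_rot; exact: xmax.
suff: ucycle (adj T) (x :: d) -> size (x :: d) = 2%N.
  by rewrite -dE size_rot.
move=> /andP[cy un] {xc x0 dE xinc c i}.
have xV : tree_vertices x.
  by case: d cy {un xmax} => [|y d] /= /andP[/tree_adj_vertices].
case: xV => b [t xE]; rewrite {}xE in cy un xmax *.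
have nb y : y \in P b t :: d -> adj T (P b t) y ->
    exists s, t = s.+1 /\ y = P b s.
  move=> yd /adjE[[b' [yE _]]|//].
  by move: (xmax _ yd); rewrite yE /lev !depthP ltnn.
case: d cy un nb {xmax} => [|y d] cy un nb.
  move: cy => /= /andP[loop _].
  case: (nb _ (mem_head _ _) loop) => s [ts e].
  by case: (P_inj e) => e' _; move: (ltnn s); rewrite -{2}e' ts leqnn.
case/lastP: d cy un nb => [//|d z] cy un nb.
move: cy; rewrite /= !rcons_path last_rcons => /andP[xy /andP[_ zx]].
have [|s [ts ye]] := nb y _ xy; first by rewrite !inE eqxx orbT.
have [||s' [ts' ze]] := nb z _ _.
- by rewrite !inE mem_rcons !inE eqxx !orbT.
- by rewrite adj_sym.
move: un; rewrite /= mem_rcons inE ye ze.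
by move: ts'; rewrite ts => -[->]; rewrite eqxx /= andbF.
Qed.

Definition flip_to (b : nat -> bool) n (v : bool) : nat -> bool :=
  fun i => if i == n then v else b i.

Lemma flip_to_agree b t v : P (flip_to b (nu t) v) t = P b t.
Proof.
by apply: P_agree => i; rewrite /flip_to; case: eqP => [->|//]; rewrite ltnn.
Qed.

(** The set of values of the next bit is written so as to cover both cases: a
    level where a bit is read, with two children, and a level where none is,
    with one child. *)
Lemma children_flip b t : children T root (P b t) =
  (fun v => P (flip_to b (nu t) v) t.+1) @`
    [set v | nu t.+1 = nu t -> v = false].
Proof.
apply/seteqP; split => [y [/adjE[]]|_ [v vP <-]].
- case=> b' [-> e] _; exists (if nu t.+1 == nu t then false else b' (nu t)).
    by move=> ->; rewrite eqxx.
  case: (P_inj e) => _ ag; apply: P_agree => i lti; rewrite /flip_to.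
  case: eqVneq => [iE|ine].
    by move: lti; rewrite iE; case: eqP => [->|//]; rewrite ltnn.
  rewrite ag// ltn_neqAle ine /=.
  by rewrite -ltnS (leq_trans lti)//; case/andP: (nuS t).
- case=> s [-> ->]; rewrite !depthP => e.
  by have := leqnSn s.+1; rewrite -e ltnn.
- split; last by rewrite !depthP.
  by rewrite -[P b t](flip_to_agree _ _ v) adj_succ.
Qed.

Lemma children_flip_inj b t :
  {in [set v | nu t.+1 = nu t -> v = false] &,
    injective (fun v => P (flip_to b (nu t) v) t.+1)}.
Proof.
move=> v v' /set_mem /= vP /set_mem /= vP' e.
case: (P_inj e) => _ ag; case: (eqVneq (nu t.+1) (nu t)) => [e'|ne].
  by rewrite vP// vP'.
have := ag (nu t); rewrite /flip_to eqxx; apply.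
by rewrite ltn_neqAle eq_sym ne; case/andP: (nuS t).
Qed.

Lemma binary_tree_symmetric : spherically_symmetric T root.
Proof.
move=> _ _ [b [t ->]] [b' [t' ->]]; rewrite !depthP => <-.
rewrite !children_flip.
apply: card_eq_trans; first exact: inj_card_eq (@children_flip_inj b t).
by rewrite card_eq_sym; exact: inj_card_eq (@children_flip_inj b' t).
Qed.

Lemma binary_tree_locally_finite x : finite_set [set y | adj T x y].
Proof.
case: (pselect (tree_vertices x)) => [[b [t ->]]|nx]; last first.
  by apply: (@sub_finite_set _ _ set0) => // y /= /tree_adj_vertices.
apply: (@sub_finite_set _ _ (children T root (P b t) `|` [set P b t.-1])).
  move=> y /= xy; case: (adjE xy) => [[b' [yE _]]|[s [-> ->]]]; last by right.
  by left; split => //; rewrite yE !depthP.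
rewrite finite_setU; split; last exact: finite_set1.
by rewrite children_flip; apply: finite_image; exact: finite_finset.
Qed.

Lemma binary_tree_infinite : infinite_set (vertices T).
Proof.
move=> fin; apply: infinite_nat.
rewrite (_ : setT = depth T root @` vertices T); first exact: finite_image.
apply/seteqP; split => // t _; exists (P (fun=> false) t); last exact: depthP.
by exists (fun=> false), t.
Qed.

Lemma binary_tree_rooted : rooted_tree T root.
Proof.
split.
- by exists (fun=> false), 0%N.
- exact: binary_tree_connected.
- exact: binary_tree_acyclic.
- exact: binary_tree_locally_finite.
- exact: binary_tree_infinite.
Qed.
(** * Cutset sums of a binary tree *)
Section Cutsets.
Variable pi : set (V * V).
Hypothesis pi_cutset : cutset T root pi.

Definition hits (b : nat -> bool) (n : nat) : Prop :=
  exists2 t, (t < n)%N & pi (P b t, P b t.+1).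

Lemma cutset_hits b : exists n, hits b n.
Proof.
case: pi_cutset => piE piR.
have [|e [[pie [i ei]] _]] := piR (P b).
  split; [exact: P_root|by move=> t t' /P_inj[]|exact: adj_succ].
exists i.+1, i => //; case: ei => eE; first by rewrite -eE.
have [_] := piE _ pie; rewrite eE /= !depthP => /eqP.
by rewrite -[_ == _]negbK neq_ltn ltnS leqnSn.
Qed.

(** The prefix of length [n] of [b] extends, for every [N], to a branch that
    avoids the cutset for [N] steps. *)
Definition misses (n : nat) (b : nat -> bool) : Prop := forall N, exists b',
  (forall i, (i < n)%N -> b' i = b i) /\ ~ hits b' N.

(** The branch of Koenig's lemma: each new bit is chosen so that the prefix still
    satisfies [misses], provided the empty prefix does. *)
Definition missing_prefix : nat -> (nat -> bool) :=
  fix F n := if n is n'.+1 then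
    if `[< misses n (flip_to (F n') n' true) >] then flip_to (F n') n' true
    else flip_to (F n') n' false
  else fun=> false.

Lemma hits_mono b m n : (m <= n)%N -> hits b m -> hits b n.
Proof. by move=> mn [t tm pt]; exists t => //; exact: leq_trans mn. Qed.

Lemma misses_extend n b : misses n b ->
  misses n.+1 (flip_to b n true) \/ misses n.+1 (flip_to b n false).
Proof.
move=> mb; apply: contrapT => /not_orP[/existsNP[M hM] /existsNP[N hN]].
have [b' [ag nh]] := mb (maxn M N).
case E : (b' n).
- apply: hM; exists b'; split=> [i|/(hits_mono (leq_maxl M N))//].
  rewrite ltnS leq_eqVlt /flip_to => /orP[/eqP->|lt]; rewrite ?eqxx//.
  by rewrite (ltn_eqF lt); exact: ag.
- apply: hN; exists b'; split=> [i|/(hits_mono (leq_maxr M N))//].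
  rewrite ltnS leq_eqVlt /flip_to => /orP[/eqP->|lt]; rewrite ?eqxx//.
  by rewrite (ltn_eqF lt); exact: ag.
Qed.

(** Compactness of the space of branches. If the cutset were avoided for
    arbitrarily long, the branch [missing_prefix] would never meet it: meeting
    it at level [t.+1] depends on the first [nu t.+1] bits only. *)
Lemma cutset_bounded : exists N, forall b, hits b N.
Proof.
apply: contrapT => nbd.
have m0 : misses 0 (missing_prefix 0).
  move=> N; apply: contrapT => no; apply: nbd; exists N => b.
  by apply: contrapT => nh; apply: no; exists b; split.
have mn n : misses n (missing_prefix n).
  elim: n => // n /misses_extend; rewrite [missing_prefix n.+1]/=.
  by case: asboolP => // nm [].
have mag n m i : (n <= m)%N -> (i < n)%N ->
    missing_prefix m i = missing_prefix n i.
  move=> nm lti; elim: m nm => [|m IH].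
    by rewrite leqn0 => /eqP n0; rewrite n0 in lti.
  rewrite leq_eqVlt => /orP[/eqP->//|]; rewrite ltnS => nm.
  have im : (i == m) = false by rewrite ltn_eqF// (leq_trans lti).
  by rewrite -IH//=; case: ifP => _; rewrite /flip_to im.
pose b n := missing_prefix n.+1 n.
have [n [t tn pt]] := cutset_hits b.
have [b' [ag nh]] := mn (nu t.+1) t.+1.
apply: nh; exists t => //.
have ag' i : (i < nu t.+1)%N -> b' i = b i.
  by move=> lti; rewrite ag// /b (mag i.+1).
rewrite (P_agree ag') (P_agree (b':=b))// => i lti; apply: ag'.
by apply: leq_trans lti _; case/andP: (nuS t).
Qed.

End Cutsets.

Lemma card_cylinder K n (w0 : K.-tuple bool) : (n <= K)%N ->
  (#|[pred w : K.-tuple bool | take n w == take n w0]| <= 2 ^ (K - n))%N.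
Proof.
move=> nK; have szd (w : K.-tuple bool) : size (drop n w) == (K - n)%N.
  by rewrite size_drop size_tuple.
rewrite -[X in (_ <= X ^ _)%N]card_bool -card_tuple.
apply: (leq_card_in (fun w => Tuple (szd w))) => w w'.
rewrite !inE => /eqP e /eqP e' [] ed; apply: val_inj.
by rewrite /= -[tval w](cat_take_drop n) -[tval w'](cat_take_drop n) e e' ed.
Qed.

(** Under fair coin flips, an edge [e] is used by a branch with probability
    [2^- nu |e|], and every branch uses an edge of the cutset. Since the cutset
    may be replaced by its finitely many edges below a fixed level, the
    argument reduces to counting words of [K] bits. *)
Lemma cutset_mass (R : realType) pi : cutset T root pi ->
  exists E : seq (V * V), [/\ uniq E, {subset E <= pi} &
    1 <= \sum_(e <- E) (2^-1 : R) ^+ nu (edepth T root e)].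
Proof.
move=> pic; have [N hN] := cutset_bounded pic.
pose K := nu N; pose word (w : K.-tuple bool) : nat -> bool := nth false w.
have /choice[f fP] : forall w, exists t,
    (t < N)%N /\ pi (P (word w) t, P (word w) t.+1).
  by move=> w; have [t tN pt] := hN (word w); exists t.
pose edge w := (P (word w) (f w), P (word w) (f w).+1).
pose E := undup [seq edge w | w : K.-tuple bool].
have edgeE w : edge w \in E by rewrite mem_undup map_f// mem_enum.
exists E; split; first exact: undup_uniq.
  by move=> e; rewrite mem_undup => /mapP[w _ ->]; apply/mem_set; case: (fP w).
(* Each word is counted once, at the edge of the cutset chosen for it. *)
have massE : (1 : R) = \sum_(e <- E) \sum_(w | edge w == e) 2^-1 ^+ K.
  under eq_bigr do rewrite big_mkcond/=.
  rewrite exchange_big/=.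
  transitivity (\sum_(w : K.-tuple bool) (2^-1 : R) ^+ K).
    rewrite sumr_const card_tuple card_bool -(mulr_natr (2^-1 ^+ K)) natrX.
    by rewrite -exprMn mulVf ?expr1n// pnatr_eq0.
  apply: eq_bigr => w _; rewrite (bigD1_seq (edge w)) ?undup_uniq//= eqxx.
  by rewrite big1 ?addr0// => e /negPf; rewrite eq_sym => ->.
rewrite [leLHS]massE big_seq [leRHS]big_seq; apply: ler_sum => e.
rewrite mem_undup => /mapP[w0 _ ->].
rewrite /edepth depthP sumr_const.
set n := nu _; have nK : (n <= K)%N by apply: nu_le; case: (fP w0).
have le : (#|[pred w | edge w == edge w0]| <= 2 ^ (K - n))%N.
  apply: leq_trans (card_cylinder w0 nK); apply: subset_leq_card.
  apply/fintype.subsetP => w; rewrite !inE => /eqP[_ /P_inj[fE ag]].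
  apply/eqP/(@eq_from_nth _ false); rewrite !size_takel ?size_tuple// => i lti.
  by rewrite !nth_take// -[nth _ w i]/(word w i) ag// fE.
rewrite -(mulr_natr (2^-1 ^+ K)).
apply: (@le_trans _ _ (2^-1 ^+ K * (2 ^ (K - n))%:R)).
  by apply: ler_wpM2l; rewrite ?exprn_ge0// ler_nat.
rewrite natrX -{1}(subnKC nK) exprD -mulrA -exprMn mulVf ?pnatr_eq0//.
by rewrite expr1n mulr1.
Qed.

Lemma cutset_sum_gt0 (R : realType) (lambda c : R) : 0 < c ->
  (forall t, c * (2^-1) ^+ nu t <= expR (- (t%:R `^ lambda))) ->
  (0 < ereal_inf [set cutset_sum T root lambda pi | pi in cutset T root])%E.
Proof.
move=> c0 hc; apply: (@lt_le_trans _ _ c%:E); first by rewrite lte_fin.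
apply/ereal_infP => _ [pi pic <-].
have [E [uE Epi mE]] := cutset_mass R pic.
apply: esum_ge; exists [set` E].
  by split; [exact: finite_seq|move=> e /Epi/set_mem].
rewrite -fsbig_seq// sumEFin lee_fin.
apply: (@le_trans _ _ (c * \sum_(e <- E) (2^-1 : R) ^+ nu (edepth T root e))).
  by rewrite ler_peMr// ltW.
by rewrite mulr_sumr; apply: ler_sum => e _; exact: hc.
Qed.

Lemma IBN_binary_tree (R : realType) (alpha : R) : 0 < alpha ->
  (forall lambda, 0 < lambda < alpha -> exists2 c : R, 0 < c &
     forall t, c * 2^-1 ^+ nu t <= expR (- (t%:R `^ lambda))) ->
  (alpha%:E <= IBN R T root)%E.
Proof.
move=> a0 hc.
have sup_ge lambda : 0 < lambda < alpha -> (lambda%:E <= IBN R T root)%E.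
  move=> la; apply: ereal_sup_ubound; right; exists lambda => //=.
  split; first by case/andP: la.
  by have [c c0 cP] := hc _ la; exact: cutset_sum_gt0 c0 cP.
apply/lee_subgt0Pr => e e0; rewrite -EFinB.
have [ea|ae] := ltP e alpha.
  by apply: sup_ge; rewrite subr_gt0 ea/= ltrBlDr ltrDl.
apply: (@le_trans _ _ 0%E); first by rewrite lee_fin subr_le0.
by apply: ereal_sup_ubound; left.
Qed.
End BinaryTree.
(** * First visits of sites *)
Section FirstVisits.
Local Open Scope nat_scope.
Variables (X : choiceType) (site : nat -> X).

Definition fresh (t : nat) : bool := site t \notin map site (iota 0 t).

Definition nfresh (t : nat) : nat := count fresh (iota 0 t).

Lemma fresh_neq i t : fresh t -> (i < t) -> site i != site t.
Proof.
by move=> ft it; apply: contraNneq ft => <-; apply: map_f; rewrite mem_iota.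
Qed.

Lemma nfreshS t : nfresh t.+1 = (nfresh t + fresh t).
Proof. by rewrite /nfresh -addn1 iotaD count_cat /= addn0. Qed.

Lemma nfresh_le : {homo nfresh : m n / (m <= n)}.
Proof.
apply: homo_leq => [//|n m p|t]; first exact: leq_trans.
by rewrite nfreshS leq_addr.
Qed.

Lemma size_undup_nfresh t : size (undup (map site (iota 0 t))) = nfresh t.
Proof.
elim: t => [//|t IH]; rewrite nfreshS -IH -addn1 iotaD map_cat /= cats1.
rewrite undup_rcons size_rcons /fresh -rem_filter ?undup_uniq//.
case: (boolP (site t \in map site (iota 0 t))) => h /=; last first.
  by rewrite addn1 rem_id// mem_undup.
rewrite addn0 size_rem ?mem_undup// prednK//.
by move: h; rewrite -mem_undup; case: undup.
Qed.

Lemma nfresh_ge (s : seq X) t : uniq s -> {subset s <= map site (iota 0 t)} ->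
  (size s <= nfresh t).
Proof.
move=> us ss; rewrite -size_undup_nfresh; apply: uniq_leq_size => // x /ss.
by rewrite mem_undup.
Qed.

Lemma fresh_enum : (forall n, exists t, (n <= nfresh t)) ->
  exists fr : nat -> nat, forall i, fresh (fr i) /\ nfresh (fr i) = i.
Proof.
move=> inf.
suff /choice[fr frP] : forall i, exists t, fresh t /\ nfresh t = i by exists fr.
move=> i; have ex : exists t, (i < nfresh t) by have [t] := inf i.+1; exists t.
case: (ex_minnP ex) => -[|t] it tmin; first by [].
exists t; move: (it); have : (nfresh t <= i).
  by rewrite leqNgt; apply/negP => /tmin; rewrite ltnn.
rewrite nfreshS; case: (fresh t) => /=; last by rewrite addn0 leqNgt => /negP.
by rewrite addn1 ltnS => h1 h2; split => //; apply/eqP; rewrite eqn_leq h1 h2.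
Qed.

Lemma fresh_lt t u : fresh u -> (nfresh t < nfresh u) -> (t < u).
Proof. by move=> fu; apply: contraTT; rewrite -!leqNgt => /nfresh_le. Qed.

(** Selecting greedily from the end: keeping the last element [x] forbids the two
    sites in [avoid x], so each selection uses up three elements at most. *)
Lemma independent_subseq (avoid : nat -> seq X) (s : seq nat) (k : nat) :
  (forall t, size (avoid t) <= 2) -> uniq (map site s) -> (3 * k <= size s) ->
  exists s', [/\ subseq s' s, size s' = k &
    pairwise (fun a b => site a \notin avoid b) s'].
Proof.
move=> av2; elim: k s => [|k IH] s us; first by exists [::]; rewrite sub0seq.
case/lastP: s us => [//|s x]; rewrite map_rcons rcons_uniq size_rcons.
move=> /andP[_ us] ks.
pose P a := site a \notin avoid x.
have few : (count (predC P) s <= 2).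
  apply: leq_trans (av2 x); rewrite -size_filter -(size_map site).
  apply: uniq_leq_size => [|_ /mapP[a + ->]].
    by apply: subseq_uniq us; apply: map_subseq; exact: filter_subseq.
  by rewrite mem_filter /= negbK => /andP[].
have [||s' [ss sz pw]] := IH [seq a <- s | P a].
- by apply: subseq_uniq us; apply: map_subseq; exact: filter_subseq.
- rewrite size_filter; move: few ks; rewrite -(count_predC P s).
  by move: (count P s) (count _ s) => m n; lia.
exists (rcons s' x); split.
- rewrite -!cats1; apply: cat_subseq => //.
  exact: subseq_trans ss (filter_subseq _ _).
- by rewrite size_rcons sz.
- rewrite pairwise_rcons pw andbT; apply/allP => a /(mem_subseq ss).
  by rewrite mem_filter => /andP[].
Qed.

(** The first visits are cut into windows of eighteen, and six are kept in each:
    a separator and an information site for each of three stages. *)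
Lemma spread_fresh_times (avoid : nat -> seq X) :
  (forall t, size (avoid t) <= 2) -> (forall n, exists t, (n <= nfresh t)) ->
  exists sel : nat -> nat, [/\ forall n, (sel n < sel n.+1),
    forall n, fresh (sel n),
    forall a b, a < b -> a %/ 6 = b %/ 6 -> site (sel a) \notin avoid (sel b) &
    forall n, (nfresh (sel n) < 3 * n + 18)].
Proof.
move=> av2 /fresh_enum[fr frP].
have frlt i j : (i < j) -> (fr i < fr j).
  move=> ij; have [fi ni] := frP i; have [fj nj] := frP j.
  by apply: fresh_lt => //; rewrite ni nj.
pose window m := [seq fr i | i <- iota (18 * m) 18].
have win_site m : uniq (map site (window m)).
  rewrite -map_comp map_inj_uniq ?iota_uniq// => i j /=.
  by case: (ltngtP i j) => // /frlt/(fresh_neq (frP _).1)/eqP h e; case: h.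
have /choice[w wP] m := independent_subseq av2 (win_site m) (leqnn (3 * 6)).
have wsz m : size (w m) = 6%N by case: (wP m).
have wsorted m : sorted ltn (w m).
  case: (wP m) => ss _ _; apply: (subseq_sorted ltn_trans ss).
  by apply: (homo_sorted frlt); exact: iota_ltn_sorted.
pose sel n := nth 0%N (w (n %/ 6)) (n %% 6).
have selP n : exists2 i, sel n = fr i & (n %/ 6 * 18 <= i < n %/ 6 * 18 + 18).
  have [ss _ _] := wP (n %/ 6).
  have : sel n \in w (n %/ 6) by rewrite mem_nth// wsz ltn_mod.
  move=> /(mem_subseq ss)/mapP[i]; rewrite mem_iota => ib ->; exists i => //.
  lia.
exists sel; split.
- move=> n; have [e|ne] := eqVneq (n.+1 %/ 6) (n %/ 6).
    rewrite /sel e; apply: (sorted_ltn_nth ltn_trans) => //.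
    + by rewrite inE wsz ltn_mod.
    + by rewrite inE wsz ltn_mod.
    + have := divn_eq n 6; have := divn_eq n.+1 6; lia.
  have [i -> ib] := selP n; have [i' -> ib'] := selP n.+1.
  by apply: frlt; have := leq_div2r 6 (leqnSn n); lia.
- by move=> n; have [i -> _] := selP n; case: (frP i).
- move=> a b ab e; rewrite /sel -e.
  have [_ _ /(pairwiseP 0%N)] := wP (a %/ 6); apply.
  + by rewrite inE wsz ltn_mod.
  + by rewrite inE wsz ltn_mod.
  + have := divn_eq a 6; have := divn_eq b 6; lia.
- move=> n; have [i -> ib] := selP n; rewrite (frP i).2.
  have := leq_divM n 6; lia.
Qed.
End FirstVisits.
(** * An infinite walk with many first visits *)
Section OrbitWalk.
Variables (G : groupType) (X : choiceType) (act : right_action G X) (x0 : X).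
Variable SG : set G.
Local Open Scope nat_scope.

(** A lamp switched at the base point [g] sits at [x0]; carried along by the later
    moves, it is recorded at [x0 g^-1], a position that does not depend on them. *)
Definition cursor (g : G) : X := act x0 g^-1%g.

Variable word : nat -> seq G.
Hypothesis size_word : forall n, size (word n) = n.
Hypothesis word_gens : forall n g, g \in word n -> SG g.

(** The concatenation of the words of lengths 1, 2, 4, ...: the word of length
    [2 ^ k] occupies the positions from [2 ^ k - 1] on. *)
Definition letter (n : nat) : G :=
  let k := trunc_log 2 n.+1 in nth 1%g (word (2 ^ k)) (n.+1 - 2 ^ k).

Fixpoint orbit_walk (n : nat) : G :=
  if n is n'.+1 then (orbit_walk n' * letter n')%g else 1%g.

Lemma orbit_walk_adj n : cayley_adj SG (orbit_walk n) (orbit_walk n.+1).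
Proof.
apply/asboolP; exists (letter n); last by left.
apply: (word_gens (n := 2 ^ trunc_log 2 n.+1)); apply: mem_nth.
rewrite size_word.
have := trunc_log_bounds (isT : 1 < 2) (isT : 0 < n.+1); rewrite /= expnS; lia.
Qed.

Lemma letter_block k i : i < 2 ^ k ->
  letter ((2 ^ k).-1 + i) = nth 1%g (word (2 ^ k)) i.
Proof.
move=> ik.
have e : ((2 ^ k).-1 + i).+1 = 2 ^ k + i by have := expn_gt0 2 k; lia.
have -> : letter ((2 ^ k).-1 + i) = nth 1%g (word (2 ^ k)) (2 ^ k + i - 2 ^ k).
  rewrite /letter e (@trunc_log_eq 2 k)//.
  by rewrite leq_addr expnS mul2n -addnn ltn_add2l.
by rewrite addKn.
Qed.

Lemma orbit_walk_block k i : i <= 2 ^ k ->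
  orbit_walk ((2 ^ k).-1 + i) =
  (orbit_walk (2 ^ k).-1 * \prod_(g <- take i (word (2 ^ k))) g)%g.
Proof.
elim: i => [|i IH] ik; first by rewrite addn0 take0 big_nil mulg1.
rewrite addnS /= IH ?(ltnW ik)// letter_block// (take_nth 1%g) ?size_word//.
by rewrite -cats1 big_cat big_seq1 mulgA.
Qed.

(** The cursor positions along a block form the inverted orbit of its word up to
    the translation [back]: dropping a prefix of [w] and dividing by [w] leaves
    the inverse of that prefix. *)
Lemma nfresh_block k :
  #|` inverted_orbit act x0 (word (2 ^ k))| <=
  nfresh (cursor \o orbit_walk) (2 ^ k.+1).-1.
Proof.
set w := word (2 ^ k); set b := (2 ^ k).-1.
pose back y := act y ((\prod_(g <- w) g)^-1 * (orbit_walk b)^-1)%g.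
have back_inj : injective back by exact: (can_inj (ractK act _)).
rewrite -(size_map back); apply: nfresh_ge.
  by rewrite map_inj_uniq ?fset_uniq.
move=> _ /mapP[y /imfsetP[i /= + ->] ->].
rewrite mem_iota add0n size_word => ik.
apply/mapP; exists (b + i).
  rewrite mem_iota add0n expnS /b; have := expn_gt0 2 k; lia.
rewrite /= /cursor /back orbit_walk_block 1?ltnW// -/w -/b -ractM.
congr (act x0 _); rewrite -[in (\prod_(g <- w) g)^-1%g](cat_take_drop i w).
by rewrite big_cat !invgM !mulgA mulgV mul1g.
Qed.
End OrbitWalk.

(** Completed blocks suffice at the cost of a constant: between the end of block
    [k] and that of block [k.+1] the time is less than [4 * 2 ^ k]. *)
Lemma nfresh_growth (R : realType) (f : nat -> nat) (alpha C : R) :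
  0 < alpha -> 0 < C -> {homo f : m n / (m <= n)%N} ->
  (forall k, C * (2 ^ k)%:R `^ alpha <= (f (2 ^ k.+1).-1)%:R) ->
  forall t, C * 4^-1 `^ alpha * t%:R `^ alpha <= (f t)%:R.
Proof.
move=> a0 C0 fm fk [|t]; first by rewrite powR0 ?gt_eqF// mulr0.
have [k kP] : exists k, (2 ^ k.+1 <= t.+2 < 2 ^ k.+2)%N.
  have := trunc_log_bounds (isT : (1 < 2)%N) (isT : (0 < t.+2)%N) => /=.
  case: (trunc_log 2 t.+2) => [|k]; last by exists k.
  by rewrite expn1 !ltnS ltn0 andbF.
apply: (@le_trans _ _ (f (2 ^ k.+1).-1)%:R); last first.
  by rewrite ler_nat; apply: fm; move: kP; have := expn_gt0 2 k.+1; lia.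
apply: le_trans (fk k); rewrite -mulrA; apply: ler_wpM2l; first exact: ltW.
rewrite -powRM ?invr_ge0//; apply: ge0_ler_powR.
- exact: ltW.
- by rewrite nnegrE mulr_ge0 ?invr_ge0.
- by rewrite nnegrE.
rewrite mulrC ltW// ltr_pdivrMr// -natrM ltr_nat.
move: kP; rewrite !expnS; lia.
Qed.
(** * Loop erasure *)
Section LoopErasure.
Variables (V : eqType) (e : rel V) (gam : nat -> V).
Hypothesis gam_adj : forall n, e (gam n) (gam n.+1).
Local Open Scope nat_scope.

Definition loop_erase (i k : nat) : seq V :=
  shorten (gam i) [seq gam n | n <- iota i.+1 (k - i)].

Lemma loop_eraseP i k : i <= k ->
  [/\ path e (gam i) (loop_erase i k), last (gam i) (loop_erase i k) = gam k,
      uniq (gam i :: loop_erase i k), size (loop_erase i k) <= k - i &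
      {subset loop_erase i k <= [seq gam n | n <- iota i.+1 (k - i)]}].
Proof.
move=> ik; rewrite /loop_erase; move: (k - i) (subnKC ik) => n <- {k ik}.
have pn m : path e (gam m) [seq gam t | t <- iota m.+1 n].
  by elim: n m => //= n IH m; rewrite gam_adj IH.
have ln m : last (gam m) [seq gam t | t <- iota m.+1 n] = gam (m + n).
  by elim: n m {pn} => [|n IH] m /=; rewrite ?addn0// IH addnS.
rewrite -ln; case/shortenP: (pn i) => p' pp' up' sub; split => //.
have -> : n = size [seq gam t | t <- iota i.+1 n] by rewrite size_map size_iota.
by apply: uniq_leq_size => //; case/andP: up'.
Qed.
End LoopErasure.

(** * The stages of a branch *)

(** States are pairs of the list of all the sites toggled so far and a base point.
    Keeping the list rather than the set lit at the end makes it grow by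
    concatenation; only parities of multiplicities matter for the lamps. *)
Section Stages.
Variables (X : choiceType) (V : choiceType) (e : rel V) (p : V -> X).
Variable gam : nat -> V.
Hypothesis e_sym : symmetric e.
Hypothesis gam_adj : forall n, e (gam n) (gam n.+1).
Local Open Scope nat_scope.

Local Notation site := (p \o gam).
Local Notation loop_erase := (loop_erase gam).

(** The last time before [t] with another site under the cursor than at [t.-1]. *)
Definition run_prev (t : nat) : nat := \max_(i < t | site i != site t.-1) i.

(** The sites of [hub j] and [past j] when [t] is [kap j], that is, the earlier
    lamps that a stage with information site at time [t] may disturb. *)
Definition touched (t : nat) : seq X := [:: site t.-1; site (run_prev t)].

Definition lamp_adj : rel (seq X * V) := fun s s' =>
  (s'.1 == s.1) && e s.2 s'.2 || (s'.2 == s.2) && (s'.1 == p s.2 :: s.1).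

Lemma lamp_adj_move l x y : e x y -> lamp_adj (l, x) (l, y).
Proof. by rewrite /lamp_adj /= eqxx => ->. Qed.

Lemma lamp_adj_toggle l x : lamp_adj (l, x) (p x :: l, x).
Proof. by rewrite /lamp_adj /= !eqxx orbT. Qed.

Lemma path_move l x s L : path e x s -> path lamp_adj (l, last x s) L ->
  path lamp_adj (l, x) (map (pair l) s ++ L).
Proof.
by elim: s x => //= y s IH x /andP[xy ys] pL; rewrite lamp_adj_move//= IH.
Qed.

Variables rho kap : nat -> nat.
Hypothesis rho_kap : forall j, rho j < kap j.
Hypothesis kap_rho : forall j, kap j < rho j.+1.
Hypothesis rho_fresh : forall j, fresh site (rho j).
Hypothesis kap_fresh : forall j, fresh site (kap j).
Hypothesis rho_untouched : forall j, site (rho j) \notin touched (kap j).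
Hypothesis kap_untouched : forall i j, i < j -> i %/ 3 = j %/ 3 ->
  site (kap i) \notin touched (kap j).

Definition sep j := site (rho j).
Definition info j := site (kap j).
Definition hub j := site (kap j).-1.
Definition past j := site (run_prev (kap j)).

Lemma kap_gt0 j : 0 < kap j.
Proof. by apply: leq_ltn_trans (rho_kap j). Qed.

(** The separator is a site other than the hub that is visited before [kap j].
    Hence the run is preceded by a different site, and it starts after
    [rho j], so that stages follow each other in time. *)
Lemma run_prevP j : [/\ rho j <= run_prev (kap j),
  run_prev (kap j) < (kap j).-1,
  past j != hub j & forall i, run_prev (kap j) < i < kap j -> site i = hub j].
Proof.
have k0 := kap_gt0 j; have rk := rho_kap j.
have rz : site (rho j) != hub j.
  by have := rho_untouched j; rewrite !inE negb_or => /andP[].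
have rle : rho j <= run_prev (kap j).
  exact: (@leq_bigmax_cond _ (fun i : 'I_(kap j) => site i != hub j) val
    (Ordinal rk)).
have [i0 i0P iE] : exists2 i0 : 'I_(kap j),
    site i0 != hub j & run_prev (kap j) = i0.
  have : 0 < #|[pred i : 'I_(kap j) | site i != hub j]|.
    by apply/card_gt0P; exists (Ordinal rk); rewrite inE.
  by case/(eq_bigmax_cond val) => i0 i0P iE; exists i0.
have past_hub : past j != hub j by rewrite /past iE.
split => //.
- have : run_prev (kap j) != (kap j).-1.
    by apply: contraNneq past_hub => E; rewrite /past E.
  by rewrite iE; have := ltn_ord i0; lia.
- move=> i /andP[lti ik]; apply/eqP; rewrite -[_ == _]negbK; apply/negP => ne.
  have : i <= run_prev (kap j).
    exact: (@leq_bigmax_cond _ (fun i : 'I_(kap j) => site i != hub j) val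
      (Ordinal ik)).
  by rewrite leqNgt lti.
Qed.

Lemma info_neq_hub j : info j != hub j.
Proof.
rewrite eq_sym; apply: fresh_neq (kap_fresh j) _.
by have := kap_gt0 j; lia.
Qed.

Lemma info_neq_past j : info j != past j.
Proof.
rewrite eq_sym; apply: fresh_neq (kap_fresh j) _.
by case: (run_prevP j) => _ + _ _; have := kap_gt0 j; lia.
Qed.

Lemma info_neq_sep j : info j != sep j.
Proof. by rewrite eq_sym; apply: fresh_neq (kap_fresh j) (rho_kap j). Qed.

Lemma past_neq_hub j : past j != hub j.
Proof. by case: (run_prevP j). Qed.

Lemma sep_neq j : sep j != hub j /\ sep j != past j.
Proof. by have := rho_untouched j; rewrite !inE negb_or => /andP[]. Qed.

Local Notation stage_sites j := [:: hub j; info j; past j; sep j].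

Definition run_start j := (run_prev (kap j)).+1.

Definition run_path j := loop_erase (run_start j) (kap j).-1.

Definition exit_path j := loop_erase (kap j).-1 (rho j.+1).

(** The part of stage [j] that precedes the choice. It starts when the separator
    has been switched on and ends when the hub is toggled. Lamps are listed
    relative to the beginning of the stage. *)
Definition stage_common j : seq (seq X * V) :=
  map (pair [:: sep j]) (gam (rho j) :: loop_erase (rho j) (run_start j)) ++
  [:: ([:: hub j; sep j], gam (run_start j))].

Definition choice_site j (c : bool) : X := if c then info j else past j.

(** The two itineraries, of the same length. With [c = true] the cursor crosses
    the run, makes an excursion to the information site and comes back to the
    end of the run; with [c = false] it makes its excursion to [past j] at the
    start of the run and then crosses it. Afterwards the hub is toggled back and
    the walk is followed up to the next separator. *)
Definition stage_rest j (c : bool) : seq (seq X * V) :=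
  (if c then
    map (pair [:: hub j; sep j]) (rcons (run_path j) (gam (kap j))) ++
    map (pair [:: info j; hub j; sep j]) [:: gam (kap j); gam (kap j).-1]
  else
    map (pair [:: hub j; sep j]) [:: gam (run_prev (kap j))] ++
    map (pair [:: past j; hub j; sep j])
      [:: gam (run_prev (kap j)), gam (run_start j) & run_path j]) ++
  map (pair [:: hub j; choice_site j c; hub j; sep j])
    (gam (kap j).-1 :: exit_path j).

Definition stage j c := stage_common j ++ stage_rest j c.

Definition stage_len j := size (stage j true).

Lemma size_stage j c : size (stage j c) = stage_len j.
Proof.
rewrite /stage_len /stage /stage_rest; case: c => //.
by rewrite !size_cat !size_map !size_rcons /=; lia.
Qed.

Lemma size_common_lt j : size (stage_common j) < stage_len j.
Proof.
by rewrite /stage_len /stage size_cat /stage_rest !size_cat !size_map /=; lia.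
Qed.

Lemma run_pathP j :
  [/\ path e (gam (run_start j)) (run_path j),
      last (gam (run_start j)) (run_path j) = gam (kap j).-1,
      uniq (gam (run_start j) :: run_path j),
      size (run_path j) <= (kap j).-1 - run_start j &
      {in gam (run_start j) :: run_path j, forall x, p x = hub j}].
Proof.
have [rw wk _ hubP] := run_prevP j.
have [pa la ua sa sub] := loop_eraseP gam_adj wk.
split => // x; rewrite inE => /orP[/eqP->|/sub/mapP[i]].
  by apply: hubP; rewrite /run_start ltnS leqnn; lia.
by rewrite mem_iota => ib ->; apply: hubP; rewrite /run_start in ib *; lia.
Qed.

Lemma exit_pathP j :
  [/\ path e (gam (kap j).-1) (exit_path j),
      last (gam (kap j).-1) (exit_path j) = gam (rho j.+1),
      uniq (gam (kap j).-1 :: exit_path j) &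
      size (exit_path j) <= rho j.+1 - (kap j).-1].
Proof.
have le : (kap j).-1 <= rho j.+1 by have := kap_rho j; lia.
by have [] := loop_eraseP gam_adj le.
Qed.

Lemma approach_pathP j :
  [/\ path e (gam (rho j)) (loop_erase (rho j) (run_start j)),
      last (gam (rho j)) (loop_erase (rho j) (run_start j)) = gam (run_start j),
      uniq (gam (rho j) :: loop_erase (rho j) (run_start j)) &
      size (loop_erase (rho j) (run_start j)) <= run_start j - rho j].
Proof.
have [rw _ _ _] := run_prevP j.
by have [] := loop_eraseP gam_adj (leqW rw).
Qed.

(** A stage lasts as long as the walk from [rho j] to [rho j.+1], up to the
    excursion and the toggles. *)
Lemma stage_len_le j : stage_len j <= rho j.+1 - rho j + 6.
Proof.
have [_ _ _ s1] := approach_pathP j; have [_ _ _ s2 _] := run_pathP j.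
have [_ _ _ s3] := exit_pathP j; have [rw wk _ _] := run_prevP j.
have rk := rho_kap j; have kr := kap_rho j; move: s1 s2 s3.
rewrite /stage_len !size_cat !size_map size_rcons /= /run_start.
lia.
Qed.

Lemma stage_path j c : exists s,
  [/\ stage j c = ([:: sep j], gam (rho j)) :: s,
      path lamp_adj ([:: sep j], gam (rho j)) s &
      last ([:: sep j], gam (rho j)) s =
        ([:: hub j; choice_site j c; hub j; sep j], gam (rho j.+1))].
Proof.
have [pa la _ _] := approach_pathP j.
have [pr lr _ _ hubr] := run_pathP j.
have [px lx _ _] := exit_pathP j.
have k0 := kap_gt0 j; have kE : (kap j).-1.+1 = kap j by rewrite prednK.
have ek : e (gam (kap j).-1) (gam (kap j)) by rewrite -{2}kE.
have toggle l x y : p x = y -> lamp_adj (l, x) (y :: l, x).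
  by move=> <-; exact: lamp_adj_toggle.
exists (map (pair [:: sep j]) (loop_erase (rho j) (run_start j)) ++
  ([:: hub j; sep j], gam (run_start j)) :: stage_rest j c); split.
- by rewrite /stage /stage_common -catA.
- apply: path_move => //; rewrite la /= toggle; last first.
    by apply: hubr; rewrite inE eqxx.
  rewrite /stage_rest; case: c.
  + rewrite -catA; apply: path_move; first by rewrite rcons_path pr lr.
    rewrite last_rcons /= toggle// lamp_adj_move ?[e (gam (kap j)) _]e_sym//=.
    rewrite toggle//= -[map _ _]cats0; exact: path_move.
  + rewrite /= lamp_adj_move ?[e (gam (run_start j)) _]e_sym//= toggle//.
    rewrite lamp_adj_move//=; apply: path_move => //; rewrite lr /= toggle//=.
    by rewrite -[map _ _]cats0; exact: path_move.
- rewrite last_cat /= [LHS]last_cat /=.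
  by rewrite (last_map (pair _)) lx.
Qed.

(** The lamps that distinguish the phases of stage [j]. *)
Definition lamp_key j (l : seq X) : bool * bool * bool :=
  (odd (count_mem (hub j) l), odd (count_mem (info j) l),
   odd (count_mem (past j) l)).

Lemma uniq_pair_map (k : bool * bool * bool) (s : seq V)
    (L : seq (bool * bool * bool * V)) :
  uniq s -> k \notin map fst L -> uniq L -> uniq (map (pair k) s ++ L).
Proof.
move=> us kL uL.
rewrite cat_uniq map_inj_uniq ?us ?uL ?andbT//; last by move=> ? ? [].
apply/hasPn => -[k' x] kx; apply: contra kL => /mapP[y _ [<- _]].
by apply/mapP; exists (k', x).
Qed.

Lemma map_fst_pair (k : bool * bool * bool) (s : seq V) :
  map fst (map (pair k) s) = nseq (size s) k.
Proof. by elim: s => //= x s ->. Qed.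

Local Ltac other_keys :=
  by rewrite ?map_cat ?mem_cat !map_fst_pair ?mem_cat !mem_nseq /= ?andbF.

Definition keyed j (s : seq X * V) := (lamp_key j s.1, s.2).

Lemma lamp_keys j : [/\ lamp_key j [:: sep j] = (false, false, false),
  lamp_key j [:: hub j; sep j] = (true, false, false),
  lamp_key j [:: info j; hub j; sep j] = (true, true, false),
  lamp_key j [:: past j; hub j; sep j] = (true, false, true) &
  lamp_key j [:: hub j; info j; hub j; sep j] = (false, true, false) /\
  lamp_key j [:: hub j; past j; hub j; sep j] = (false, false, true)].
Proof.
have E1 := negPf (info_neq_hub j); have E2 := negPf (info_neq_past j).
have E3 := negPf (info_neq_sep j); have E4 := negPf (past_neq_hub j).
have [/negPf E5 /negPf E6] := sep_neq j.
have F := (E1, E2, E3, E4, E5, E6).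
have F' := (etrans (eq_sym _ _) E1, etrans (eq_sym _ _) E2,
  etrans (eq_sym _ _) E3, etrans (eq_sym _ _) E4,
  etrans (eq_sym _ _) E5, etrans (eq_sym _ _) E6).
by rewrite /lamp_key /= !eqxx !(F, F').
Qed.

Lemma keyed_map j l s :
  map (keyed j) (map (pair l) s) = map (pair (lamp_key j l)) s.
Proof. by rewrite -map_comp. Qed.

Lemma keyed_common j : map (keyed j) (stage_common j) =
  map (pair (false, false, false))
    (gam (rho j) :: loop_erase (rho j) (run_start j)) ++
  map (pair (true, false, false)) [:: gam (run_start j)].
Proof.
have [k1 k2 _ _ _] := lamp_keys j.
by rewrite /stage_common map_cat keyed_map k1 /= /keyed /= k2.
Qed.

Lemma keyed_rest j c : map (keyed j) (stage_rest j c) =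
  (if c then
    map (pair (true, false, false)) (rcons (run_path j) (gam (kap j))) ++
    map (pair (true, true, false)) [:: gam (kap j); gam (kap j).-1]
  else
    map (pair (true, false, false)) [:: gam (run_prev (kap j))] ++
    map (pair (true, false, true))
      [:: gam (run_prev (kap j)), gam (run_start j) & run_path j]) ++
  map (pair (false, c, ~~ c)) (gam (kap j).-1 :: exit_path j).
Proof.
have [k1 k2 k3 k4 [k5 k6]] := lamp_keys j.
by case: c; rewrite /stage_rest !map_cat !keyed_map ?k1 ?k2 ?k3 ?k4 ?k5 ?k6.
Qed.

Lemma past_notin_run j :
  gam (run_prev (kap j)) \notin gam (run_start j) :: run_path j.
Proof.
have [_ _ _ _ hubr] := run_pathP j.
apply/negP => /hubr; apply/eqP; exact: past_neq_hub.
Qed.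

Lemma info_notin_run j : gam (kap j) \notin gam (run_start j) :: run_path j.
Proof.
have [_ _ _ _ hubr] := run_pathP j.
apply/negP => /hubr; apply/eqP; exact: info_neq_hub.
Qed.

(** Successive phases have different keys, and each phase follows a self-avoiding
    path, because the excursions leave the sites of the run. *)
Lemma keyed_stage_uniq j c : uniq (map (keyed j) (stage j c)).
Proof.
have [_ _ u1 _] := approach_pathP j; have [_ _ u2 _ hubr] := run_pathP j.
have [_ _ u3 _] := exit_pathP j.
have key_neq (x y : V) : p x != p y -> x != y by apply: contraNneq => ->.
rewrite /stage map_cat keyed_common keyed_rest -catA; case: c.
- rewrite (_ : _ ++ _ ++ _ =
    map (pair (false, false, false))
    (gam (rho j) :: loop_erase (rho j) (run_start j)) ++
    map (pair (true, false, false))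
      (gam (run_start j) :: rcons (run_path j) (gam (kap j))) ++
    map (pair (true, true, false)) [:: gam (kap j); gam (kap j).-1] ++
    map (pair (false, true, false)) (gam (kap j).-1 :: exit_path j) ++ [::]);
    last by rewrite cats0 -!catA.
  apply: uniq_pair_map; [by []|other_keys|].
  apply: uniq_pair_map; [|other_keys|].
    by rewrite -rcons_cons rcons_uniq info_notin_run.
  apply: uniq_pair_map; [|other_keys|by apply: uniq_pair_map].
  by rewrite /= andbT inE key_neq// info_neq_hub.
- rewrite (_ : _ ++ _ ++ _ =
    map (pair (false, false, false))
    (gam (rho j) :: loop_erase (rho j) (run_start j)) ++
    map (pair (true, false, false))
      [:: gam (run_start j); gam (run_prev (kap j))] ++
    map (pair (true, false, true))
      [:: gam (run_prev (kap j)), gam (run_start j) & run_path j] ++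
    map (pair (false, false, true)) (gam (kap j).-1 :: exit_path j) ++ [::]);
    last by rewrite cats0 -!catA.
  apply: uniq_pair_map; [by []|other_keys|].
  apply: uniq_pair_map; [|other_keys|].
    have := past_notin_run j; rewrite inE negb_or eq_sym => /andP[ne _].
    by rewrite /= inE ne.
  apply: uniq_pair_map; [|other_keys|by apply: uniq_pair_map].
  by rewrite cons_uniq past_notin_run.
Qed.

(** After the choice the two itineraries share only the key of the phase that
    starts at the hub. There one visits the run and the information site, the
    other the base point before the run. *)
Lemma keyed_rest_disjoint j s : s \in map (keyed j) (stage_rest j true) ->
  s \notin map (keyed j) (stage_rest j false).
Proof.
rewrite !keyed_rest !mem_cat => h; apply/negP; move: h.
move=> /orP[/orP[]|] /mapP[x xs ->] /orP[/orP[]|] /mapP[y ys [//]] E.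
move: ys; rewrite inE -E => /eqP xE; move: xs; rewrite xE mem_rcons inE.
apply/negP; rewrite negb_or; have := past_notin_run j.
rewrite inE negb_or => /andP[_ ->]; rewrite andbT.
apply/eqP => h; move: (info_neq_past j); rewrite /info /past /= h eqxx//.
Qed.

Lemma keyed_stage_inj j c c' o o' s0 :
  o < stage_len j -> o' < stage_len j ->
  keyed j (nth s0 (stage j c) o) = keyed j (nth s0 (stage j c') o') ->
  o = o' /\ (size (stage_common j) <= o -> c = c').
Proof.
wlog ne : c c' o o' / (c = c') \/ (c = true /\ c' = false).
  move=> H ol ol' E; case: c c' E => -[] E; try by apply: H => //; tauto.
  have [] := H true false o' o (or_intror (conj erefl erefl)) ol' ol (esym E).
  by move=> -> h; split => // /h.
move=> ol ol'.
have same d i i' : i < stage_len j -> i' < stage_len j ->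
    keyed j (nth s0 (stage j d) i) = keyed j (nth s0 (stage j d) i') -> i = i'.
  move=> il il' /eqP; rewrite -!(nth_map s0 (keyed j s0)) ?size_stage//.
  by rewrite nth_uniq ?keyed_stage_uniq ?size_map ?size_stage// => /eqP.
case: ne => [<- /same->//|[-> ->]].
have low d d' i : i < size (stage_common j) ->
  nth s0 (stage j d) i = nth s0 (stage j d') i by rewrite /stage !nth_cat => ->.
have [lo|ge] := ltnP o (size (stage_common j)).
  by rewrite (low _ false)// => /same->.
have [lo'|ge'] := ltnP o' (size (stage_common j)).
  by rewrite [in RHS](low _ true)// => /same E; rewrite E// leqNgt lo' in ge.
have inrest d i : i < stage_len j -> size (stage_common j) <= i ->
    keyed j (nth s0 (stage j d) i) \in map (keyed j) (stage_rest j d).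
  move=> il ig; rewrite /stage nth_cat ifN -?leqNgt//.
  apply: map_f; apply: mem_nth.
  by rewrite ltn_subLR// -size_cat [size _](size_stage j d).
move=> E; have := keyed_rest_disjoint (inrest true o ol ge).
by rewrite E inrest.
Qed.

(** The sites toggled before stage [j]; those of a stage are in reverse order. *)
Fixpoint lamps_before (c : nat -> bool) (j : nat) : seq X :=
  if j is i.+1 then
    [:: hub i; choice_site i (c i); hub i; sep i] ++ lamps_before c i
  else [::].

Lemma odd_lamps_before c j x : odd (count_mem x (lamps_before c j.+1)) =
  (sep j == x) (+) (choice_site j (c j) == x) (+)
  odd (count_mem x (lamps_before c j)).
Proof. by rewrite /= !oddD !oddb; do 3!case: (_ == x); case: odd. Qed.

Lemma stage_site j x : x \in stage_sites j ->
  exists2 t, t <= kap j & x = site t.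
Proof.
have rk := rho_kap j; have [_ wk _ _] := run_prevP j.
by rewrite !inE => /or4P[] /eqP ->; eexists; try reflexivity; lia.
Qed.

Lemma choice_site_in j c : choice_site j c \in stage_sites j.
Proof. by case: c; rewrite !inE eqxx ?orbT. Qed.

Lemma rho_lt i j : i < j -> kap i < rho j.
Proof.
elim: j => // j IH; rewrite ltnS leq_eqVlt => /orP[/eqP->|/IH h].
  exact: kap_rho.
by apply: (ltn_trans h); apply: (ltn_trans (rho_kap j)); exact: kap_rho.
Qed.

Lemma lamps_before_site c j x : x \in lamps_before c j ->
  exists2 t, t < rho j & x = site t.
Proof.
elim: j => //= j IH; have kr := kap_rho j; have rk := rho_kap j.
have H y : y \in stage_sites j ->
    exists2 t, t < rho j.+1 & y = site t.
  by case/stage_site => t tk ->; exists t => //; apply: leq_ltn_trans tk kr.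
rewrite !in_cons => /or4P[/eqP->|/eqP->|/eqP->|].
- by apply: H; rewrite inE eqxx.
- by apply: H; exact: choice_site_in.
- by apply: H; rewrite inE eqxx.
- move=> /orP[/eqP->|/IH[t tr ->]]; first by apply: H; rewrite !inE eqxx !orbT.
  by exists t => //; lia.
Qed.

Lemma fresh_lamps_before c j t : fresh site t -> rho j <= t ->
  site t \notin lamps_before c j.
Proof.
move=> ft jt; apply/negP => /lamps_before_site[u ur E].
by have := fresh_neq ft (leq_trans ur jt); rewrite E eqxx.
Qed.

Lemma fresh_stage j t : fresh site t -> kap j < t ->
  site t \notin stage_sites j.
Proof.
move=> ft jt; apply/negP => /stage_site[u ur E].
by have := fresh_neq ft (leq_ltn_trans ur jt); rewrite E eqxx.
Qed.

Lemma stage_lamps j c s : s \in stage j c ->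
  {subset s.1 <= stage_sites j} /\ odd (count_mem (sep j) s.1).
Proof.
have [/negPf sh /negPf sp] := sep_neq j; have := info_neq_sep j => /negPf si.
have cin := choice_site_in j c.
have cs : (choice_site j c == sep j) = false.
  by case: (c); rewrite /= ?si// eq_sym.
pose L := [:: [:: sep j]; [:: hub j; sep j];
  [:: choice_site j c; hub j; sep j];
  [:: hub j; choice_site j c; hub j; sep j]].
have LP l t : l \in L -> all (fun s => s.1 \in L) (map (pair l) t).
  by move=> lL; elim: t => //= x t ->; rewrite lL.
have /allP/(_ s) sP : all (fun s => s.1 \in L) (stage j c).
  rewrite /stage /stage_common /stage_rest.
  by case: (c) @L LP => L LP; rewrite !all_cat all_seq1 !LP ?inE ?eqxx ?orbT.
move=> /sP {sP}; rewrite /L.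
have hin : hub j \in stage_sites j by rewrite inE eqxx.
have sin : sep j \in stage_sites j by rewrite !inE eqxx !orbT.
move: (stage_sites j) hin sin cin => S hin sin cin.
have sub l : all (fun x => x \in S) l -> {subset l <= S} by move/allP.
rewrite !inE => /or4P[] /eqP ->; split;
  by [apply: sub; rewrite /= ?hin ?sin ?cin
     |rewrite /= ?eqxx ?[hub j == _]eq_sym ?sh ?cs].
Qed.

(** The information site of stage [i] still differs at stage [j], provided that
    the stages in between either agree or belong to the same triple: the former
    contribute equally, the latter leave this site alone. *)
Lemma info_differs c c' i j : i < j -> c i != c' i ->
  (forall k, i < k < j -> c k = c' k \/ i %/ 3 = k %/ 3) ->
  odd (count_mem (info i) (lamps_before c j)) !=
  odd (count_mem (info i) (lamps_before c' j)).
Proof.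
elim: j => // j IH; rewrite ltnS leq_eqVlt => /orP[/eqP<- cc _|ij cc ag].
  rewrite !odd_lamps_before [sep i == _]eq_sym (negPf (info_neq_sep i)) /=.
  have n0 d : count_mem (info i) (lamps_before d i) = 0.
    by apply/count_memPn/fresh_lamps_before => //; rewrite ltnW.
  rewrite !n0 !addbF; have := info_neq_past i; rewrite eq_sym => /negPf np.
  by case: (c i) (c' i) cc => -[] //= _; rewrite eqxx np.
rewrite !odd_lamps_before.
have -> : (choice_site j (c j) == info i) = (choice_site j (c' j) == info i).
  have ij' : kap i < kap j by apply: ltn_trans (rho_lt ij) (rho_kap j).
  have [|->//|grp] := ag j; first by rewrite ij /=.
  have := kap_untouched ij grp; rewrite !inE negb_or => /andP[_ ne].
  have f d : (choice_site j d == info i) = false.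
    case: d => /=; apply/negbTE; last by rewrite eq_sym.
    by rewrite eq_sym; exact: fresh_neq (kap_fresh j) ij'.
  by rewrite !f.
rewrite (inj_eq (@addbI _)); apply: IH => // k /andP[ik kj].
by apply: ag; rewrite ik ltnW.
Qed.

(** Equality of the lamp configurations that two lists of toggles produce. *)
Definition same_lamps (l l' : seq X) : Prop :=
  forall x, odd (count_mem x l) = odd (count_mem x l').

(** The repetition code: every bit is used by three consecutive stages. *)
Definition expand (b : nat -> bool) : nat -> bool := fun j => b (j %/ 3).

(** Take the last stage [i] before [j] with different choices. In the triple of
    [j], the selection of the sites protects [info i]. In an earlier triple, all
    three stages of it differ, and of the three information sites at least one is
    neither [hub j] nor [past j]. *)
Lemma lamps_before_far b b' j i : i < j -> expand b i != expand b' i ->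
  exists2 x, x \notin stage_sites j &
    odd (count_mem x (lamps_before (expand b) j)) !=
    odd (count_mem x (lamps_before (expand b') j)).
Proof.
move=> ij0 bb0.
have ex : exists k, (k < j) && (expand b k != expand b' k).
  by exists i; rewrite ij0.
have bd k : (k < j) && (expand b k != expand b' k) -> k <= j.
  by case/andP => /ltnW.
case: (ex_maxnP ex bd) => {ij0 bb0 ex bd}i /andP[ij bb] imax.
have ag k : i < k < j -> expand b k = expand b' k.
  move=> /andP[ik kj]; apply/eqP; rewrite -[_ == _]negbK; apply/negP => ne.
  by have := imax k; rewrite kj ne leqNgt ik => /(_ isT).
have infos k : k < j -> info k \notin [:: info j; sep j].
  move=> kj; have kr := rho_lt kj; have rk := rho_kap j.
  rewrite !inE negb_or (fresh_neq (kap_fresh j)) ?(ltn_trans kr)//=.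
  exact: fresh_neq (rho_fresh j) kr.
have avoid x : x \notin [:: info j; sep j] -> x \notin touched (kap j) ->
    x \notin stage_sites j.
  by rewrite !inE !negb_or => /andP[-> ->] /andP[-> ->].
have [grp|grp] := eqVneq (i %/ 3) (j %/ 3).
  exists (info i); first by apply: avoid; [exact: infos|exact: kap_untouched].
  by apply: info_differs => // k /ag; left.
have lt3 : i %/ 3 < j %/ 3 by rewrite ltn_neqAle grp leq_div2r// ltnW.
(* The last difference is at the end of its triple. *)
have iE : i = i %/ 3 * 3 + 2.
  have := divn_eq i 3; have := ltn_mod i 3; have := leq_divM j 3 => h1 h2 h3.
  apply/eqP; rewrite -[_ == _]negbK; apply/negP => ne.
  have e3 : i.+1 %/ 3 = i %/ 3 by lia.
  have : i.+1 <= i by apply: imax; rewrite /expand e3 bb andbT; lia.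
  by rewrite ltnn.
have jm : i %/ 3 * 3 + 2 < j by rewrite -iE.
have grpE k : i %/ 3 * 3 <= k <= i -> k %/ 3 = i %/ 3 by lia.
have diff k : i %/ 3 * 3 <= k <= i ->
    odd (count_mem (info k) (lamps_before (expand b) j)) !=
    odd (count_mem (info k) (lamps_before (expand b') j)).
  move=> ki; apply: info_differs; first by lia.
    by rewrite /expand grpE.
  move=> n /andP[kn nj]; have [ni|ni] := leqP n i.
    by right; rewrite !grpE//; lia.
  by left; apply: ag; rewrite ni.
have uq : uniq [seq info k | k <- iota (i %/ 3 * 3) 3].
  rewrite map_inj_in_uniq ?iota_uniq// => k n _ _ kn.
  have lt u v : u < v -> info u != info v.
    move=> uv; apply: fresh_neq (kap_fresh v) _.
    exact: ltn_trans (rho_lt uv) (rho_kap v).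
  by case: (ltngtP k n) => // /lt; rewrite kn eqxx.
have [k ki kt] : exists2 k, k \in iota (i %/ 3 * 3) 3 &
    info k \notin touched (kap j).
  apply: contrapT => none.
  have sub :
      {subset [seq info k | k <- iota (i %/ 3 * 3) 3] <= touched (kap j)}.
    move=> _ /mapP[k ki ->]; rewrite -[_ \in _]negbK; apply/negP => kt.
    by apply: none; exists k.
  by have := uniq_leq_size uq sub.
have ki' : i %/ 3 * 3 <= k <= i by move: ki; rewrite mem_iota; lia.
exists (info k); last exact: diff.
by apply: avoid => //; apply: infos; lia.
Qed.

(** The stage, and the offset in it, of the state reached after [t] steps. *)
Fixpoint locate (t : nat) : nat * nat :=
  if t is t'.+1 then
    let: (j, o) := locate t' in
    if o.+1 < stage_len j then (j, o.+1) else (j.+1, 0)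
  else (0, 0).

Lemma locateS t : locate t.+1 = let: (j, o) := locate t in
  if o.+1 < stage_len j then (j, o.+1) else (j.+1, 0).
Proof. by []. Qed.

Definition stage_start j := \sum_(i < j) stage_len i.

Lemma stage_len_gt0 j : 0 < stage_len j.
Proof. exact: leq_ltn_trans (size_common_lt j). Qed.

Lemma locateP t j o : locate t = (j, o) ->
  t = stage_start j + o /\ o < stage_len j.
Proof.
elim: t j o => [|t IH] j o /=.
  by case=> <- <-; rewrite /stage_start big_ord0 stage_len_gt0.
case: (locate t) IH => j' o' /(_ _ _ erefl)[-> ol].
case: ltnP => h [<- <-]; first by rewrite addnS.
rewrite stage_len_gt0 addn0 /stage_start big_ord_recr /= -addnS.
by split => //; congr (_ + _); apply/eqP; rewrite eqn_leq ol h.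
Qed.

Definition ray_state (c : nat -> bool) (t : nat) : seq X * V :=
  let: (j, o) := locate t in
  let s := nth ([::], gam 0) (stage j (c j)) o in
  (s.1 ++ lamps_before c j, s.2).

Lemma ray_state_adj c t : lamp_adj (ray_state c t) (ray_state c t.+1).
Proof.
rewrite /ray_state /=; case E : (locate t) => [j o].
have [_ ol] := locateP E; have [s [sE sp sl]] := stage_path j (c j).
have lenE : stage_len j = (size s).+1 by rewrite -(size_stage j (c j)) sE.
case: ltnP => [ol'|le].
  have := sp => /(pathP ([::], gam 0)) /(_ o).
  rewrite -ltnS -lenE => /(_ ol'); rewrite sE.
  have -> : nth ([::], gam 0) s o =
    nth ([::], gam 0) (([:: sep j], gam (rho j)) :: s) o.+1 by [].
  rewrite /lamp_adj /= => /orP[/andP[/eqP -> ->]|/andP[/eqP -> /eqP ->]].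
    by rewrite eqxx.
  by rewrite !eqxx orbT.
have oE : o = size s by apply/eqP; rewrite -eqSS -lenE eqn_leq ol le.
have [s' [sE' _ _]] := stage_path j.+1 (c j.+1).
rewrite sE' sE oE -last_nth sl.
exact: lamp_adj_toggle.
Qed.

(** The number of choices already visible after [t] steps. *)
Definition known (t : nat) : nat :=
  let: (j, o) := locate t in j + (size (stage_common j) <= o).

Lemma knownS t : known t <= known t.+1 <= (known t).+1.
Proof.
rewrite /known locateS; case E : (locate t) => [j o]; have [_ ol] := locateP E.
have sc := size_common_lt j; case: (ltnP o.+1 (stage_len j)) => h.
  have [h1|h1] := leqP (size (stage_common j)) o.
    have -> : size (stage_common j) <= o.+1 by exact: leqW.
    by rewrite leqnn leqnSn.
  by case: (_ <= o.+1); rewrite /= ?addn0 ?addn1 ?leqnn ?leqnSn.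
have -> : size (stage_common j) <= o by lia.
have -> : (size (stage_common j.+1) <= 0) = false.
  by rewrite /stage_common size_cat /= addn1.
by rewrite /= addn0 addn1 leqnn leqnSn.
Qed.

Lemma lamps_before_agree c c' j : (forall i, i < j -> c i = c' i) ->
  lamps_before c j = lamps_before c' j.
Proof.
elim: j => //= j IH ag; rewrite ag// IH// => i ij; apply: ag; exact: ltnW.
Qed.

Lemma ray_state_agree c c' t : (forall i, i < known t -> c i = c' i) ->
  ray_state c t = ray_state c' t.
Proof.
rewrite /known /ray_state; case: (locate t) => j o ag.
rewrite (lamps_before_agree (c' := c')) => [|i ij]; last first.
  by apply: ag; exact: ltn_addr.
suff -> : nth ([::], gam 0) (stage j (c j)) o =
  nth ([::], gam 0) (stage j (c' j)) o by [].
have [le|gt] := leqP (size (stage_common j)) o.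
  by rewrite ag// le addn1.
by rewrite /stage !nth_cat gt.
Qed.

Lemma nth_stage_in c j o : o < stage_len j ->
  nth ([::], gam 0) (stage j c) o \in stage j c.
Proof. by move=> ol; rewrite mem_nth// size_stage. Qed.

Lemma count_outside (l S : seq X) x : {subset l <= S} -> x \notin S ->
  count_mem x l = 0.
Proof. by move=> lS xS; apply/count_memPn; apply: contra xS => /lS. Qed.

(** The separator of stage [j'] is on throughout this stage, and its site has not
    been visited at any earlier stage. *)
Lemma ray_state_inj_stage b b' t t' j j' o o' :
  locate t = (j, o) -> locate t' = (j', o') -> j < j' ->
  ~ same_lamps (ray_state (expand b) t).1 (ray_state (expand b') t').1.
Proof.
move=> E E' jj /(_ (sep j')).
have [_ ol] := locateP E; have [_ ol'] := locateP E'.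
rewrite /ray_state E E' /= !count_cat.
have [sub _] := stage_lamps (nth_stage_in (expand b j) ol).
have [_] := stage_lamps (nth_stage_in (expand b' j') ol').
have kr := rho_lt jj; have rk := rho_kap j.
rewrite !oddD => ->.
rewrite (count_outside sub (fresh_stage (rho_fresh j') kr)).
have f c k : k <= j' -> count_mem (sep j') (lamps_before c k) = 0.
  move=> kj; apply/count_memPn/fresh_lamps_before => //.
  move: kj; rewrite leq_eqVlt => /orP[/eqP->//|/rho_lt h].
  exact/ltnW/(ltn_trans (rho_kap k)).
by rewrite !f// ltnW.
Qed.

(** Different earlier choices would be seen at a site outside the current stage.
    With equal histories the comparison takes place within one stage. *)
Lemma ray_state_inj b b' t t' :
  same_lamps (ray_state (expand b) t).1 (ray_state (expand b') t').1 ->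
  (ray_state (expand b) t).2 = (ray_state (expand b') t').2 ->
  t = t' /\ forall i, i < known t -> expand b i = expand b' i.
Proof.
move=> sl; case E : (locate t) => [j o]; case E' : (locate t') => [j' o'].
have [tE ol] := locateP E; have [tE' ol'] := locateP E'.
have [jj|jj|jj] := ltngtP j j'.
- by case: (ray_state_inj_stage E E' jj sl).
- by case: (@ray_state_inj_stage b' b _ _ _ _ _ _ E' E jj) => x; rewrite sl.
subst j'; move: sl; rewrite /ray_state /known E E' /= => sl gE.
have [sub _] := stage_lamps (nth_stage_in (expand b j) ol).
have [sub' _] := stage_lamps (nth_stage_in (expand b' j) ol').
have ag i : i < j -> expand b i = expand b' i.
  move=> ij; apply/eqP; rewrite -[_ == _]negbK; apply/negP => ne.
  have [x xout] := lamps_before_far ij ne; have := sl x.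
  rewrite !count_cat (count_outside sub xout) (count_outside sub' xout) !add0n.
  by move=> ->; rewrite eqxx.
have lE := lamps_before_agree ag.
have keyE : keyed j (nth ([::], gam 0) (stage j (expand b j)) o) =
            keyed j (nth ([::], gam 0) (stage j (expand b' j)) o').
  rewrite /keyed gE /lamp_key.
  have par x :
      odd (count_mem x (nth ([::], gam 0) (stage j (expand b j)) o).1) =
      odd (count_mem x (nth ([::], gam 0) (stage j (expand b' j)) o').1).
    by have := sl x; rewrite !count_cat !oddD lE => /addIb.
  by rewrite !par.
have [oE cE] := keyed_stage_inj ol ol' keyE.
rewrite tE tE'; split => [|i]; first by rewrite oE.
case: (leqP (size (stage_common j)) o) => [h|_]; last first.
  by rewrite addn0; exact: ag.
rewrite addn1 ltnS leq_eqVlt => /orP[/eqP->|]; last exact: ag.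
exact: cE.
Qed.

Lemma stage_start_le j : stage_start j <= 7 * rho j.
Proof.
suff : stage_start j <= rho j + 6 * j /\ j <= rho j by lia.
rewrite /stage_start; elim: j => [|j [IH jr]]; first by rewrite big_ord0.
rewrite big_ord_recr /=.
have := stage_len_le j; have := rho_kap j; have := kap_rho j; move: IH jr.
move: (\sum_(i < j) _) (stage_len j) (kap j) (rho j) (rho j.+1) => S l k r r'.
by split; lia.
Qed.

Lemma known_lower t : t < 7 * rho (known t).+1.
Proof.
rewrite /known; case E : (locate t) => [j o]; have [tE ol] := locateP E.
have : t < stage_start j.+1.
  by rewrite tE /stage_start big_ord_recr /= ltn_add2l.
move/leq_trans; apply; apply: leq_trans (stage_start_le _) _.
rewrite leq_mul2l /=.
case: (_ <= o) => /=; rewrite ?addn1 ?addn0//.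
by apply/ltnW/(ltn_trans (rho_kap _))/kap_rho.
Qed.
End Stages.
(** * From growth to the intermediate branching number *)

(** Beyond [t0] the power [t^lambda] is dominated by [ln 2 * d * t^alpha]; below, it
    is bounded by [M]. *)
Lemma stretched_exp_bound (R : realType) (f : nat -> nat) (alpha lambda d : R) :
  0 < lambda < alpha -> 0 < d ->
  (forall t, d * t%:R `^ alpha <= (f t)%:R + 2) ->
  exists2 c : R, 0 < c & forall t, c * 2^-1 ^+ f t <= expR (- (t%:R `^ lambda)).
Proof.
move=> /andP[l0 la] d0 hf; pose D := ln 2 * d.
have ln2 : 0 < ln 2 :> R by rewrite ln_gt0// ltr1n.
have D0 : 0 < D by rewrite mulr_gt0.
have al0 : 0 < alpha - lambda by rewrite subr_gt0.
pose t0 := D^-1 `^ (alpha - lambda)^-1; pose M := t0 `^ lambda.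
have key (t : nat) : t%:R `^ lambda <= D * t%:R `^ alpha + M.
  have [tt0|t0t] := leP (t%:R : R) t0.
    apply: (@le_trans _ _ M); last by rewrite lerDr mulr_ge0 ?powR_ge0// ltW.
    by apply: ge0_ler_powR; rewrite ?nnegrE ?powR_ge0// ltW.
  have t_gt0 : 0 < t%:R :> R by apply: le_lt_trans t0t; exact: powR_ge0.
  apply: (@le_trans _ _ (D * t%:R `^ alpha)); last by rewrite lerDl powR_ge0.
  have -> : alpha = (alpha - lambda) + lambda by rewrite subrK.
  rewrite powRD; last by rewrite (gt_eqF t_gt0) implybT.
  rewrite mulrA ler_peMl ?powR_ge0// -ler_pdivrMl// mulr1.
  have -> : D^-1 = t0 `^ (alpha - lambda).
    by rewrite -powRrM mulVf ?gt_eqF// powRr1// invr_ge0 ltW.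
  by apply: ge0_ler_powR; rewrite ?nnegrE ?powR_ge0// ltW.
exists (expR (- (M + ln 2 * 2))); first exact: expR_gt0.
move=> t; have -> : (2^-1 : R) ^+ f t = expR (- (ln 2 * (f t)%:R)).
  by rewrite expRN expRM_natr lnK ?posrE// exprVn.
rewrite -expRD ler_expR -opprD lerN2.
apply: le_trans (key t) _; rewrite addrC -addrA lerD2l -mulrDr /D -mulrA.
by rewrite ler_pM2l// addrC.
Qed.

(** * Lamp configurations in the wreath product *)
Section Embedding.
Variables (A G : groupType) (X : choiceType) (act : right_action G X) (x0 : X).
Variables (SA : set A) (SG : set G) (s : A).
Hypothesis SAs : SA s.
Hypothesis s_neq1 : s != 1%g.

Definition lit (l : seq X) (y : X) : A :=
  if odd (count_mem y l) then s else 1%g.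

(** The lamp recorded at [y] has moved to [y g] in the element with base [g]. *)
Definition lamplighter (st : seq X * G) : wreath A act :=
  Wreath act
    [fsfun x in [fset act y st.2 | y in st.1]%fset =>
       lit st.1 (act x st.2^-1%g)]
    st.2.

Lemma lamplighterE st x : lamp (lamplighter st) x = lit st.1 (act x st.2^-1%g).
Proof.
rewrite fsfunE; case: ifPn => // /imfsetP xout; rewrite /lit.
have -> : count_mem (act x st.2^-1%g) st.1 = 0%N; last by [].
apply/count_memPn/negP => xin; apply: xout.
by exists (act x st.2^-1%g) => //=; rewrite ractVK.
Qed.

Lemma lamplighter_inj st st' : lamplighter st = lamplighter st' ->
  same_lamps st.1 st'.1 /\ st.2 = st'.2.
Proof.
move=> e; have e2 : st.2 = st'.2 := congr1 (@base _ _ _ _) e.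
split => // y.
have : lamp (lamplighter st) (act y st.2) = lamp (lamplighter st') (act y st.2).
  by rewrite e.
rewrite !lamplighterE -e2 ractK /lit.
by case: odd; case: odd => // /eqP; rewrite ?[1%g == _]eq_sym (negPf s_neq1).
Qed.

(** Toggling a lamp is the generator [s] or its inverse, according as the lamp is
    off or on. *)
Lemma lamplighter_adj st st' :
  lamp_adj (cayley_adj SG) (cursor act x0) st st' ->
  cayley_adj (wreath_gens act x0 SA SG) (lamplighter st) (lamplighter st').
Proof.
case: st st' => l g [l' g'] /orP[/andP[/eqP /= -> /asboolP[h Sh gh]]|
  /andP[/eqP /= -> /eqP /= ->]]; apply/asboolP.
- have move_eq k : lamplighter (l, (k * h)%g) =
      (lamplighter (l, k) * wreath_of_base A act h)%g.
    apply: wreathP => // x.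
    rewrite lamps_mulE lamps_shiftE !lamplighterE /= fsfunE mulg1.
    by rewrite invgM ractM.
  exists (wreath_of_base A act h); first by right; exists h.
  by case: gh => ->; rewrite move_eq; [left|right].
- exists (wreath_of_lamp act x0 s); first by left; exists s.
  have toggle_eq l1 l2 :
      (forall y, y != cursor act x0 g -> lit l2 y = lit l1 y) ->
      lit l2 (cursor act x0 g) = (lit l1 (cursor act x0 g) * s)%g ->
      lamplighter (l2, g) = (lamplighter (l1, g) * wreath_of_lamp act x0 s)%g.
    move=> off on; apply: wreathP => [x|]; last by rewrite /= mulg1.
    rewrite lamps_mulE lamps_shiftE !lamplighterE /= fsfunE in_fset1.
    rewrite invg1 ract1.
    case: eqP => [->//|/eqP xx0]; rewrite mulg1 off//.
    by apply: contra xx0 => /eqP/(can_inj (ractK act _)) ->.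
  have off y : y != cursor act x0 g -> lit (cursor act x0 g :: l) y = lit l y.
    by rewrite eq_sym /lit /= => /negPf ->.
  case: (boolP (odd (count_mem (cursor act x0 g) l))) => par; [right|left].
    apply: toggle_eq => [y /off->//|].
    by rewrite /lit /= eqxx oddD par /= mul1g.
  apply: toggle_eq => [y /off->//|].
  by rewrite /lit /= eqxx oddD (negPf par) /= mul1g.
Qed.

Lemma cayley_adj_mul (H : groupType) (S : set H) (h u v : H) :
  cayley_adj S u v -> cayley_adj S (h * u)%g (h * v)%g.
Proof.
by move=> /asboolP[t St [->|->]]; apply/asboolP; exists t; rewrite ?mulgA; auto.
Qed.
End Embedding.

Theorem theorem5p1 (R : realType) (A G : groupType) (X : choiceType)
    (act : right_action G X) (x0 : X) (SA : set A) (SG : set G)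
    (hSA : generates SA) (hSG : generates SG)
    (alpha : R) (halpha : 0 < alpha)
    (hcard : exists a b : A, [/\ SA a, SA b & a != b])
    (horbit : exists2 C2 : R, 0 < C2 & forall n : nat,
       exists w : n.-tuple G, (forall i : 'I_n, SG (tnth w i)) /\
         C2 * n%:R `^ alpha <= #|` inverted_orbit act x0 w |%:R) :
  exists T : graph (wreath A act),
    [/\ subgraph T (cayley (wreath_gens act x0 SA SG)),
        rooted_tree T 1%g,
        spherically_symmetric T 1%g
      & (alpha%:E <= IBN R T 1%g)%E].
Proof.
have [s [SAs s1]] : exists s : A, SA s /\ s != 1%g.
  have [a [b [Sa Sb ab]]] := hcard.
  have [a1|] := eqVneq a 1%g; last by exists a.
  by exists b; split => //; rewrite -a1 eq_sym.
have [C C0 hword] := horbit.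
have /choice[word wordP] : forall n, exists w : seq G, [/\ size w = n,
    forall g, g \in w -> SG g &
    C * n%:R `^ alpha <= #|` inverted_orbit act x0 w |%:R].
  move=> n; have [w [wS wC]] := hword n.
  exists w; rewrite size_tuple; split => //.
  by move=> g /tnthP[i ->].
have word_size n : size (word n) = n by case: (wordP n).
have word_in n g : g \in word n -> SG g by case: (wordP n) => _ + _; apply.
pose gam := orbit_walk word.
have gam_adj n : cayley_adj SG (gam n) (gam n.+1) :=
  orbit_walk_adj word_size word_in n.
pose site := cursor act x0 \o gam.
have growth : forall t, C * 4^-1 `^ alpha * t%:R `^ alpha <= (nfresh site t)%:R.
  apply: nfresh_growth => //; first exact: nfresh_le.
  move=> k; have [_ _ h] := wordP (2 ^ k)%N.
  apply: le_trans h _; rewrite ler_nat.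
  exact: (nfresh_block act x0 word_size).
set c0 := C * 4^-1 `^ alpha in growth.
have c0_gt0 : 0 < c0 by rewrite mulr_gt0// powR_gt0// invr_gt0.
have infinite n : exists t, (n <= nfresh site t)%N.
  pose x := (n%:R / c0) `^ alpha^-1; exists (Num.bound x).
  rewrite -(ler_nat R); apply: le_trans (growth _).
  rewrite -ler_pdivrMl// mulrC.
  have -> : n%:R / c0 = x `^ alpha.
    by rewrite -powRrM mulVf ?gt_eqF// powRr1// divr_ge0// ltW.
  apply: ge0_ler_powR; rewrite ?nnegrE ?powR_ge0 ?ltW//.
  by apply: archi_boundP; exact: powR_ge0.
have [sel [selS sel_fresh sel_untouched sel_nfresh]] :=
  spread_fresh_times (avoid := touched (cursor act x0) gam) (fun=> isT)
    infinite.
pose rho j := sel (2 * j)%N; pose kap j := sel (2 * j).+1%N.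
have rho_kap j : (rho j < kap j)%N by exact: selS.
have kap_rho j : (kap j < rho j.+1)%N by rewrite /rho mulnS; exact: selS.
have rho_untouched j : site (rho j) \notin touched (cursor act x0) gam (kap j).
  by apply: sel_untouched => //; lia.
have kap_untouched i j : (i < j)%N -> (i %/ 3 = j %/ 3)%N ->
    site (kap i) \notin touched (cursor act x0) gam (kap j).
  by move=> ij grp; apply: sel_untouched; lia.
pose state := ray_state (cursor act x0) gam rho kap.
pose know := known (cursor act x0) gam rho kap.
pose P0 b t := lamplighter act s (state (expand b) t).
(* The branches start at the first separator; a translation brings this vertex
   to the identity. *)
pose P b t := ((P0 (fun=> false) 0%N)^-1 * P0 b t)%g.
(* A bit is read at the first of its three stages, hence the rounding up. *)
pose nu t := ((know t + 2) %/ 3)%N.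
have nu0 : nu 0%N = 0%N by [].
have nuS t : (nu t <= nu t.+1 <= (nu t).+1)%N.
  have := knownS (cursor act x0) gam rho kap t.
  by rewrite /nu -/(know t) -/(know t.+1); lia.
have P_agree b b' t : (forall i, (i < nu t)%N -> b i = b' i) -> P b t = P b' t.
  move=> ag; rewrite /P /P0 /state; congr (_ * lamplighter _ _ _)%g.
  apply: ray_state_agree => i; rewrite -/(know t) => ik; apply: ag.
  rewrite /nu; lia.
have P_inj b b' t t' : P b t = P b' t' ->
    t = t' /\ forall i, (i < nu t)%N -> b i = b' i.
  move=> /mulgI/(lamplighter_inj s1)[sl ge].
  have [tt ag] := ray_state_inj gam_adj rho_kap kap_rho
    (fun j => sel_fresh _) (fun j => sel_fresh _) rho_untouched kap_untouched
    sl ge.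
  split => // i ik; have := ag (3 * i)%N; rewrite /expand mulKn//; apply.
  by rewrite -/(know t); move: ik; rewrite /nu; lia.
have root1 : P (fun=> false) 0%N = 1%g by rewrite /P mulVg.
exists (binary_tree P); rewrite -root1; split.
- have adjP b t : cayley_adj (wreath_gens act x0 SA SG) (P b t) (P b t.+1).
    apply: cayley_adj_mul; apply: lamplighter_adj => //.
    by apply: ray_state_adj => //; exact: cayley_adj_sym.
  split=> [//|x y /orP[]/asboolP[b [t [-> ->]]]]; first exact: adjP.
  by rewrite adj_sym; exact: adjP.
- exact: (binary_tree_rooted nu0 nuS).
- exact: (binary_tree_symmetric nu0 nuS).
apply: (IBN_binary_tree nu0 nuS) => // lambda la.
apply: (stretched_exp_bound (d := c0 * 7^-1 `^ alpha / 18) la) => [|t].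
  by rewrite divr_gt0// mulr_gt0// powR_gt0// invr_gt0.
have tu : (t < 7 * rho (know t).+1)%N by exact: (known_lower gam_adj).
have nu_know : (nfresh site (rho (know t).+1) <= 18 * nu t + 24)%N.
  by have := sel_nfresh (2 * (know t).+1)%N; rewrite -/(rho _) /nu; lia.
have -> : c0 * 7^-1 `^ alpha / 18 * t%:R `^ alpha =
    c0 * (7^-1 * t%:R) `^ alpha / 18.
  by rewrite powRM ?invr_ge0//; ring.
rewrite ler_pdivrMr//.
apply: (@le_trans _ _ (18 * nu t + 24)%:R); last by rewrite natrD natrM; lra.
apply: (@le_trans _ _ (nfresh site (rho (know t).+1))%:R); last first.
  by rewrite ler_nat.
apply: le_trans (growth _); rewrite ler_pM2l//.
apply: ge0_ler_powR; rewrite ?nnegrE ?mulr_ge0 ?invr_ge0//; first exact: ltW.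
by rewrite ler_pdivrMl// -natrM ler_nat ltnW.
Qed.
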